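(* Let $(P)$ be the optimal control problem with data $L$, $\varphi$, $\Omega$, $[a,b]$ described in the context, and suppose that $(P)$ is quasi-invariant under an $r$-parameter family of transformations $h^s(t,x,u)=\left(T(t,x,u,s),X(t,x,u,s),U(t,x,u,s)\right)$, $s=(s_1,\ldots,s_r)$, $\|s\|<\varepsilon$, with associated function $F$ (in the sense defined in the context). Then, for any Pontryagin extremal $\left(x(\cdot),u(\cdot),\psi_0,\psi(\cdot)\right)$ of $(P)$ and for every $k=1,\ldots,r$, the expression $$\psi_0 \left.\frac{\partial F\left(t,x(t),u(t),s\right)}{\partial s_k}\right|_{s = 0} + \psi(t) \cdot \left.\frac{\partial X\left(t,x(t),u(t),s\right)}{\partial s_k}\right|_{s = 0} - H(t,x(t),u(t),\psi_0,\psi(t)) \left.\frac{\partial T\left(t,x(t),u(t),s\right)}{\partial s_k}\right|_{s = 0}$$ is constant in $t\in[a,b]$, where $H(t,x,u,\psi_0,\psi)=\psi_0 L(t,x,u)+\psi\cdot\varphi(t,x,u)$.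
   Context: Optimal control problem $(P)$: minimize $J[x(\cdot),u(\cdot)]=\int_a^b L(t,x(t),u(t))\,dt$ over absolutely continuous state trajectories $x(\cdot):[a,b]\to\mathbb{R}^n$ and measurable, essentially bounded controls $u(\cdot):[a,b]\to\Omega$, where $\Omega\subseteq\mathbb{R}^m$ is a given set, subject to $\dot x(t)=\varphi(t,x(t),u(t))$ for almost all $t\in[a,b]$. The functions $L:\mathbb{R}\times\mathbb{R}^n\times\mathbb{R}^m\to\mathbb{R}$ and $\varphi:\mathbb{R}\times\mathbb{R}^n\times\mathbb{R}^m\to\mathbb{R}^n$ are of class $C^1$. Boundary conditions are arbitrary. A pair $(x(\cdot),u(\cdot))$ in these classes satisfying the control system is called admissible. Hamiltonian: $H(t,x,u,\psi_0,\psi)=\psi_0 L(t,x,u)+\psi\cdot\varphi(t,x,u)$, with $\psi_0\in\mathbb{R}$, $\psi\in\mathbb{R}^n$. Pontryagin extremal: a quadruple $(x(\cdot),u(\cdot),\psi_0,\psi(\cdot))$ with $x(\cdot)$, $u(\cdot)$ in the classes above, $\psi_0\le 0$ a constant, $\psi(\cdot):[a,b]\to\mathbb{R}^n$ absolutely continuous, $(\psi_0,\psi(\cdot))$ nonzero, such that for almost all $t\in[a,b]$: (i) $\dot x(t)=\frac{\partial H}{\partial\psi}(t,x(t),u(t),\psi_0,\psi(t))$ and $\dot\psi(t)=-\frac{\partial H}{\partial x}(t,x(t),u(t),\psi_0,\psi(t))$; (ii) $H(t,x(t),u(t),\psi_0,\psi(t))=\max_{v\in\Omega}H(t,x(t),v,\psi_0,\psi(t))$.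 Quasi-invariance: problem $(P)$ is quasi-invariant under $h^s$ if $h^s:[a,b]\times\mathbb{R}^n\times\Omega\to\mathbb{R}\times\mathbb{R}^n\times\mathbb{R}^m$, $h^s(t,x,u)=(T(t,x,u,s),X(t,x,u,s),U(t,x,u,s))$, $s=(s_1,\ldots,s_r)$, $\|s\|=\sqrt{\sum_{k=1}^r s_k^2}<\varepsilon$, is a $C^1$ $r$-parameter family of transformations with $h^0(t,x,u)=(t,x,u)$ for all $(t,x,u)\in[a,b]\times\mathbb{R}^n\times\Omega$, and there is a function $F=F(t,x,u,s)$ of class $C^1$ such that, along all admissible pairs $(x(\cdot),u(\cdot))$ and for almost all $t$, $$L(t,x(t),u(t))+\frac{d}{dt}F(t,x(t),u(t),s)+o(s)=L\circ h^s(t,x(t),u(t))\,\frac{d}{dt}T(t,x(t),u(t),s),$$ $$\frac{d}{dt}X(t,x(t),u(t),s)+o(s)=\varphi\circ h^s(t,x(t),u(t))\,\frac{d}{dt}T(t,x(t),u(t),s),$$ where $o(s)$ denotes terms (possibly different in each equation) with $\lim_{\|s\|\to0}o(s)/\|s\|=0$. The family need not form a group. Conventions: $\frac{d}{dt}$ of a composite function of $t$ denotes its derivative for almost all $t$, the function being understood to be absolutely continuous in $t$. It is assumed throughout that the order of differentiation with respect to $t$ and $s_k$ can be reversed for $T$, $X$ and $F$ along admissible pairs: $\left.\frac{\partial}{\partial s_k}\frac{d}{dt}G\right|_{s=0}=\frac{d}{dt}\left.\frac{\partial G}{\partial s_k}\right|_{s=0}$ for $G=T,X,F$ (in particular the functions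 on both sides exist). Since controls are measurable functions, identities in $t$ are understood up to sets of measure zero.
   Formalization: The formal theorem adds that U(t,x,u,s) lies in Ω for all s near 0, for each (t,x,u) in [a,b]×R^n×Ω; without it the claim fails (Ω={0}, L=u, φ=0, T=t, X=x, U=u+s, F=st gives the expression -t). *)

(* Defs.v *)
From HB Require Import structures.
From mathcomp Require Import all_boot all_order all_algebra.
From mathcomp Require Import all_classical all_reals all_analysis.
From mathcomp Require Import measurable_realfun.

Set Implicit Arguments.
Unset Strict Implicit.
Unset Printing Implicit Defensive.

Import Order.TTheory GRing.Theory Num.Theory.
Import numFieldNormedType.Exports.

Local Open Scope classical_set_scope.
Local Open Scope ring_scope.

Section euclidean.
Variable R : realType.

Definition dotv n (v w : 'rV[R]_n) : R := \sum_(i < n) v 0 i * w 0 i.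

(* The library norm on 'rV[R]_n is the sup norm. *)
Definition enorm n (v : 'rV[R]_n) : R := Num.sqrt (\sum_(i < n) v 0 i ^+ 2).

Definition basisv n (i : 'I_n) : 'rV[R]_n := delta_mx 0 i.

Definition grad n (f : 'rV[R]_n -> R) (v : 'rV[R]_n) : 'rV[R]_n :=
  \row_i 'D_(basisv i) f v.

(* C^1 on an arbitrary subset A (here often not open): restriction to A of a
   function of class C^1 on an open neighbourhood of A. For V of finite
   dimension, continuity of p |-> 'D_v g p for every v is continuity of the
   differential. For A = setT this is the usual notion. *)
Definition C1_on (V W : normedModType R) (A : set V) (f : V -> W) : Prop :=
  exists (O : set V) (g : V -> W),
    [/\ open O, A `<=` O, (forall p, A p -> f p = g p) &
        forall p, O p ->
          differentiable g p /\ forall v, {for p, continuous ('D_v g)}].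

End euclidean.

Section absolute_continuity.
Variables (R : realType) (V : normedModType R) (a b : R).
Local Notation mu := (@lebesgue_measure R).

Definition abs_continuous (g : R -> V) : Prop :=
  forall e : R, 0 < e -> exists2 d : R, 0 < d &
    forall (N : nat) (l r : 'I_N -> R),
      (forall i, [/\ a <= l i, l i <= r i & r i <= b]) ->
      trivIset setT (fun i => [set` `]l i, r i[]) ->
      \sum_i (r i - l i) < d ->
      \sum_i `|g (r i) - g (l i)| < e.

Definition is_ac_rep (f g : R -> V) : Prop :=
  abs_continuous g /\ \forall t \ae mu, t \in `[a, b] -> f t = g t.

Definition ae_abs_continuous (f : R -> V) : Prop := exists g, is_ac_rep f g.

(* Functions of t built from a control are only meaningful up to null sets, so
   their d/dt is the derivative of the absolutely continuous representative,
   which is unique on [a, b]. *)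
Definition ac_rep (f : R -> V) : R -> V := xget f [set g | is_ac_rep f g].

Definition ddt (f : R -> V) : R -> V := derive1 (ac_rep f).

End absolute_continuity.

Section measurable_control.
Variables (R : realType) (m : nat) (a b : R).
Local Notation mu := (@lebesgue_measure R).

(* The real line with the sigma-algebra of Lebesgue (not only Borel)
   measurable sets. *)
Definition lebesgueType := g_sigma_algebraType (completed_algebra_gen mu).

Definition lebesgue_measurable (u : R -> 'rV[R]_m) : Prop :=
  forall i, measurable_fun ([set` `[a, b]] : set lebesgueType)
                           (fun t : lebesgueType => u t 0 i).

Definition ess_bounded (u : R -> 'rV[R]_m) : Prop :=
  exists M : R, \forall t \ae mu, t \in `[a, b] -> `|u t| <= M.

End measurable_control.

Record control_problem (R : realType) (n m : nat) := ControlProblem {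
  cp_a : R;
  cp_b : R;
  cp_L : R -> 'rV[R]_n -> 'rV[R]_m -> R;
  cp_phi : R -> 'rV[R]_n -> 'rV[R]_m -> 'rV[R]_n;
  cp_Omega : set 'rV[R]_m;
  cp_ltab : cp_a < cp_b;
  cp_L_C1 : C1_on setT
    (fun p : R * 'rV[R]_n * 'rV[R]_m => cp_L p.1.1 p.1.2 p.2);
  cp_phi_C1 : C1_on setT
    (fun p : R * 'rV[R]_n * 'rV[R]_m => cp_phi p.1.1 p.1.2 p.2)
}.

Section control.
Variables (R : realType) (n m : nat) (P : control_problem R n m).
Local Notation mu := (@lebesgue_measure R).
Local Notation a := (cp_a P).
Local Notation b := (cp_b P).
Local Notation L := (cp_L P).
Local Notation phi := (cp_phi P).
Local Notation Omega := (cp_Omega P).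
Implicit Types (x psi : R -> 'rV[R]_n) (u : R -> 'rV[R]_m).

Definition trajectory x u : Prop :=
  [/\ abs_continuous a b x, lebesgue_measurable a b u, ess_bounded a b u &
      forall t, t \in `[a, b] -> Omega (u t)].

Definition admissible x u : Prop :=
  trajectory x u /\
  \forall t \ae mu, t \in `[a, b] -> is_derive t 1 x (phi t (x t) (u t)).

Definition hamiltonian (t : R) (y : 'rV[R]_n) (v : 'rV[R]_m) (psi0 : R)
    (p : 'rV[R]_n) : R :=
  psi0 * L t y v + dotv p (phi t y v).

Definition extremal x u (psi0 : R) psi : Prop :=
  [/\ trajectory x u, psi0 <= 0, abs_continuous a b psi,
      ~ (psi0 = 0 /\ forall t, t \in `[a, b] -> psi t = 0) &
      \forall t \ae mu, t \in `[a, b] ->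
        [/\ is_derive t 1 x
              (grad (fun p => hamiltonian t (x t) (u t) psi0 p) (psi t)),
            is_derive t 1 psi
              (- grad (fun y => hamiltonian t y (u t) psi0 (psi t)) (x t)) &
            forall v, Omega v ->
              hamiltonian t (x t) v psi0 (psi t) <=
              hamiltonian t (x t) (u t) psi0 (psi t)]].

End control.

Section families.
Variables (R : realType) (n m r : nat) (P : control_problem R n m).
Local Notation mu := (@lebesgue_measure R).
Local Notation a := (cp_a P).
Local Notation b := (cp_b P).
Local Notation L := (cp_L P).
Local Notation phi := (cp_phi P).
Local Notation Omega := (cp_Omega P).
Implicit Types (x : R -> 'rV[R]_n) (u : R -> 'rV[R]_m).

Definition param_family (V : Type) :=
  R -> 'rV[R]_n -> 'rV[R]_m -> 'rV[R]_r -> V.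

Definition family_dom (eps : R) : set (R * 'rV[R]_n * 'rV[R]_m * 'rV[R]_r) :=
  [set p | [/\ p.1.1.1 \in `[a, b], Omega p.1.2 & enorm p.2 < eps]].

Definition C1_family (V : normedModType R) (eps : R)
    (G : param_family V) : Prop :=
  C1_on (family_dom eps)
    (fun p : R * 'rV[R]_n * 'rV[R]_m * 'rV[R]_r => G p.1.1.1 p.1.1.2 p.1.2 p.2).

Definition along (V : Type) (G : param_family V) x u (s : 'rV[R]_r)
    (t : R) : V :=
  G t (x t) (u t) s.

Definition ds0 (V : normedModType R) (G : param_family V) x u (k : 'I_r)
    (t : R) : V :=
  'D_(basisv R k) (fun s => along G x u s t) 0.

(* d/ds_k d/dt G = d/dt dG/ds_k at s = 0 along (x, u), all the derivatives
   involved being required to exist. *)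
Definition ds_dt_interchange (V : normedModType R)
    (G : param_family V) x u : Prop :=
  forall k : 'I_r,
    ae_abs_continuous a b (ds0 G x u k) /\
    \forall t \ae mu, t \in `[a, b] ->
      [/\ \forall c \near (0 : R),
            derivable (ac_rep a b (along G x u (c *: basisv R k))) t 1,
          derivable (ac_rep a b (ds0 G x u k)) t 1 &
          is_derive 0 (basisv R k) (fun s => ddt a b (along G x u s) t)
            (ddt a b (ds0 G x u k) t)].

Definition little_o (V : normedModType R) (o : 'rV[R]_r -> V) : Prop :=
  (enorm s)^-1 *: o s @[s --> (0 : 'rV[R]_r)^'] --> (0 : V).

(* The remainders oL, oX depend on t and on the pair, and for each s the
   identities may fail on a null set of t which depends on s. *)
Definition invariance_identities (eps : R) (T : param_family R)
    (X : param_family 'rV[R]_n) (U : param_family 'rV[R]_m)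
    (F : param_family R) x u : Prop :=
  (forall s, enorm s < eps ->
    [/\ ae_abs_continuous a b (along T x u s),
        ae_abs_continuous a b (along X x u s) &
        ae_abs_continuous a b (along F x u s)]) /\
  exists (oL : R -> 'rV[R]_r -> R) (oX : R -> 'rV[R]_r -> 'rV[R]_n),
    (\forall t \ae mu, t \in `[a, b] -> little_o (oL t) /\ little_o (oX t)) /\
    forall s, enorm s < eps -> \forall t \ae mu, t \in `[a, b] ->
      L t (x t) (u t) + ddt a b (along F x u s) t + oL t s =
        L (along T x u s t) (along X x u s t) (along U x u s t)
          * ddt a b (along T x u s) t
      /\
      ddt a b (along X x u s) t + oX t s =
        ddt a b (along T x u s) t *:
          phi (along T x u s t) (along X x u s t) (along U x u s t).

Definition quasi_invariant (eps : R) (T : param_family R)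
    (X : param_family 'rV[R]_n) (U : param_family 'rV[R]_m)
    (F : param_family R) : Prop :=
  [/\ [/\ C1_family eps T, C1_family eps X, C1_family eps U & C1_family eps F],
      forall t y v, t \in `[a, b] -> Omega v ->
        [/\ T t y v 0 = t, X t y v 0 = y & U t y v 0 = v] &
      forall x u, admissible P x u -> invariance_identities eps T X U F x u].

(* quasi_invariant does not force U to take values in Omega, since L and phi
   are defined for all control values, and without that the conservation law
   fails: for Omega = {0}, L = u, phi = 0, T = t, X = x, U = u + s, F = s t,
   the family is quasi-invariant, while x = 0, u = 0, psi0 = -1, psi = 0 is an
   extremal for which psi0 dF/ds = - t. The requirement is local in s; it holds
   for every open Omega, U being continuous with U = u at s = 0. *)
Definition control_preserving (U : param_family 'rV[R]_m) : Prop :=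
  forall t y v, t \in `[a, b] -> Omega v ->
    \forall s \near (0 : 'rV[R]_r), Omega (U t y v s).

End families.

Arguments param_family : clear implicits.

(* Main.v *)
Require Import Defs.
From mathcomp Require Import all_boot all_order all_algebra.
From mathcomp Require Import all_classical all_reals all_analysis.
From mathcomp Require Import ring lra.

Import Order.TTheory GRing.Theory Num.Theory.
Import numFieldNormedType.Exports.

Local Open Scope classical_set_scope.
Local Open Scope ring_scope.

(* Differentiating the quasi-invariance identities in s_k at s = 0 and pairing
   them with (psi0, psi) gives, for a.e. t,
     psi0 (F_s)' + psi . (X_s)' = dH (T_s, X_s, U_s) + H (T_s)',
   and dH (0, 0, U_s) = 0 because the control u(t) maximizes H and U preserves
   Omega. The delicate point is H along the extremal. Let hmax(t) be the
   supremum of H(t, x(t), v, psi0, psi(t)) over the v in Omega below the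
   essential bound of u: it is absolutely continuous, equals H(t, x(t), u(t),
   psi0, psi(t)) for a.e. t, and lies above the frozen function
   g(s) = H(s, x(s), u(t), psi0, psi(s)), with contact at s = t. With g in place
   of hmax the conserved quantity has derivative 0 at t, so the increments of the
   true one are at most o(|s - t|) where T_s > 0, at least -o(|s - t|) where
   T_s < 0, and o(|s - t|) where T_s = 0. An absolutely continuous function whose
   increments satisfy the upper bound at a.e. t is constant: its right upper Dini
   derivatives and those of its reflection are nonpositive. This gives constancy
   first where T_s <> 0 and then everywhere, without differentiating hmax and
   without any integration. *)

(** * Absolutely continuous functions and Dini derivatives *)

Section null_sets.
Set Implicit Arguments.
Unset Strict Implicit.
Variable R : realType.
Local Notation mu := (@lebesgue_measure R).

(* The only feature of null sets that absolute continuity needs; unlike the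
   measure-theoretic notion it is visibly stable under reflection. *)
Definition itv_null (N : set R) := forall d : R, 0 < d ->
  exists O : set R, [/\ open O, N `<=` O &
    forall K (l r : 'I_K -> R),
      (forall i, l i <= r i /\ [set` `[l i, r i]] `<=` O) ->
      trivIset setT (fun i => [set` `]l i, r i[]) ->
      \sum_i (r i - l i) < d].

(** Outer regularity encloses a measurable null superset of [N] in an open [G] with [mu G < d].
    Nonoverlapping intervals inside [G] then have total length at most [mu G], by additivity over
    their interiors. *)
Lemma negligible_itv_null (N : set R) : mu.-negligible N -> itv_null N.
Proof.
move=> [A [mA A0 NA]] d d0.
have Aoo : (mu A < +oo)%E by rewrite [mu A]A0 ltry.
have [G [oO AO muO]] := lebesgue_regularity_outer mA Aoo d0.
exists G; split => //; first exact: subset_trans AO.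
move=> K l r lr tr.
have mO : measurable G by exact: measurable_realfun.open_measurable.
have mitv i : measurable [set` `]l i, r i[] by exact: measurable_itv.
have muOd : (mu G < d%:E)%E.
  apply: le_lt_trans muO; rewrite -{1}(setDUK AO) measureU//.
  - by rewrite [X in (X + _)%E]A0 add0e.
  - exact: measurableD.
  - by rewrite setDIK.
rewrite -lte_fin; apply: le_lt_trans muOd.
rewrite -sumEFin (eq_bigr (fun i => mu [set` `]l i, r i[])); last first.
  move=> i _; rewrite lebesgue_measure_itv/= lte_fin.
  case: ltP => // rl; have [lri _] := lr i.
  by have -> : r i = l i by [apply/eqP; rewrite eq_le rl lri]; rewrite subrr.
rewrite -measure_bigsetU_ord//.
apply: le_measure; rewrite ?inE//; first exact: bigsetU_measurable.
apply: (big_ind (fun S => S `<=` G)) => //; first by move=> S S' SO S'O t [/SO|/S'O].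
move=> i _ t /= ti; have [_] := lr i; apply => /=.
by move: ti; rewrite !in_itv/= => /andP[/ltW -> /ltW ->].
Qed.

End null_sets.

Section dini.
Set Implicit Arguments.
Unset Strict Implicit.
Variable R : realType.
Implicit Types (a b : R) (f : R -> R).

Lemma abs_continuous_unif (V : normedModType R) a b (f : R -> V) :
  abs_continuous a b f -> forall e, 0 < e -> exists2 d, 0 < d &
    forall s t, a <= s -> s <= t -> t <= b -> t - s < d -> `|f t - f s| < e.
Proof.
move=> acf e /acf[d d0 H]; exists d => // s t as_ st tb std.
have := H 1%N (fun=> s) (fun=> t); rewrite !big_ord1; apply=> //.
by move=> i j _ _ _; rewrite !ord1.
Qed.

(** [ac_dini_le] keeps its intervals as an increasing chain indexed by [nat], so that one more can
    be appended on the right; absolute continuity asks for disjointness instead. *)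
Lemma trivIset_chain K (l r : nat -> R) :
  (forall i j, (i < j < K)%N -> r i <= l j) ->
  trivIset setT (fun i : 'I_K => [set` `]l i, r i[]).
Proof.
move=> lr i j _ _ [t /= []]; rewrite !in_itv/= => /andP[lit tri] /andP[ljt trj].
apply/val_inj; case: (ltngtP (i : nat) j) => // ij.
- have := lr i j; rewrite ij ltn_ord => /(_ isT) rl.
  by have := lt_trans (lt_le_trans tri rl) ljt; rewrite ltxx.
- have := lr j i; rewrite ij ltn_ord => /(_ isT) rl.
  by have := lt_trans (lt_le_trans trj rl) lit; rewrite ltxx.
Qed.

(** The growth of [f] is charged either to the slope [e], outside [N], or to finitely many intervals
    inside an open [G] containing [N]. The latter have total length below [d], so absolute
    continuity bounds their share by [eps / 3]. *)
Lemma ac_dini_le a b f (N : set R) : a <= b -> abs_continuous a b f ->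
  itv_null N ->
  (forall t e, a <= t < b -> ~ N t -> 0 < e ->
    \forall tau \near t^'+, f tau - f t <= e * (tau - t)) ->
  f b <= f a.
Proof.
move=> ab acf nN dini; apply/ler_addgt0Pr => eps eps0.
(* One third of [eps] each for the slope, the variation over the intervals and the slack [eta]. The
   [+ 1] keeps the denominator positive when [a = b]. *)
pose e := eps / (3 * (b - a + 1)).
have e0 : 0 < e by rewrite divr_gt0// mulr_gt0//; lra.
have eba : e * (b - a) <= eps / 3.
  by rewrite /e mulrAC ler_pdivrMr; nra.
have eps30 : 0 < eps / 3 by rewrite divr_gt0.
have [d d0 acd] := acf _ eps30.
have [G [oG NG Gd]] := nN _ d0.
pose fam (t : R) K (l r : nat -> R) :=
  (forall i, (i < K)%N ->
    [/\ a <= l i, l i <= r i, r i <= t & [set` `[l i, r i]] `<=` G]) /\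
  (forall i j, (i < j < K)%N -> r i <= l j).
(* Real induction on [Q t]: outside [N] the increment of [f] is paid for by the
   slope [e], at points of [N] by one more interval inside [G]. *)
pose Q (t : R) := forall eta, 0 < eta -> exists K l r, fam t K l r /\
  f t - f a <= e * (t - a) + \sum_(i < K) `|f (r i) - f (l i)| + eta.
have famS s t K l r : s <= t -> fam s K l r -> fam t K l r.
  move=> st [h1 h2]; split => // i /h1[? ? ris ?]; split => //.
  exact: le_trans ris st.
suff Qb : Q b.
  have [K [l [r [[fam1 fam2] fb]]]] := Qb _ eps30.
  have := acd K (fun i => l i) (fun i => r i).
  have tr := trivIset_chain fam2.
  move=> /(_ _ tr (Gd _ _ _ _ tr)) sm.
  rewrite -lerBlDl; apply: le_trans fb _.
  suff : \sum_(i < K) `|f (r i) - f (l i)| <= eps / 3 by lra.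
  by apply/ltW/sm => i; have [] := fam1 i (ltn_ord i).
pose S := [set t | a <= t <= b /\ Q t].
have Sa : S a.
  split; rewrite ?lexx// => eta eta0; exists 0%N, (fun=> 0), (fun=> 0).
  split; first by split => // i j /andP[_].
  by rewrite big_ord0 !subrr mulr0 !add0r ltW.
have hsS : has_sup S by split; [exists a|exists b => t [/andP[]]].
pose s := sup S.
have aS : a <= s by exact: (ub_le_sup hsS.2 Sa).
have sb : s <= b by apply: ge_sup => [|t [/andP[]]]; first by exists a.
(* The supremum is attained: continuity of [f] costs [eta / 2] between [s] and a nearby point of
   [S], whose own slack is the other half. This is why [Q] carries [eta]. *)
have Qs : Q s.
  move=> eta eta0; have eta20 : 0 < eta / 2 by rewrite divr_gt0.
  have [d' d'0 fd'] := abs_continuous_unif acf eta20.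
  have [t St std] := sup_adherent d'0 hsS.
  have [/andP[at_ tb] Qt] := St.
  have ts : t <= s by exact: (ub_le_sup hsS.2 St).
  have [K [l [r [ft ht]]]] := Qt _ eta20.
  exists K, l, r; split; first exact: famS ft.
  have : `|f s - f t| < eta / 2 by apply: fd' => //; rewrite -/s in std; lra.
  rewrite ltr_norml => /andP[_ fst].
  have : e * (t - a) <= e * (s - a) by rewrite ler_pM2l//; lra.
  lra.
have [->//|sneb] := eqVneq b s.
have {sneb} sltb : s < b by rewrite lt_neqAle sb eq_sym sneb.
suff [t [st tb Qt]] : exists t, [/\ s < t, t <= b & Q t].
  suff : t <= s by lra.
  by apply: (ub_le_sup hsS.2); split=> //; apply/andP; split => //; lra.
have [Ns|Ns] := pselect (N s); last first.
  have : \forall t \near s^'+, [/\ s < t, t <= b & f t - f s <= e * (t - s)].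
    near=> t; split; [by near: t; exact: nbhs_right_gt| |].
      by apply/ltW; near: t; exact: nbhs_right_lt.
    by near: t; apply: dini => //; rewrite aS.
  move=> /filter_ex[t [st tb ft]]; exists t; split => // eta eta0.
  have [K [l [r [fs hs]]]] := Qs _ eta0.
  exists K, l, r; split; first by apply: famS fs; exact: ltW.
  have : e * (t - a) = e * (t - s) + e * (s - a) by rewrite -mulrDr; congr (_ * _); lra.
  lra.
(* At a point of [N] no bound on the increment is known, but a ball around [s] lies in [G], so the
   segment from [s] to [t] can be appended to the chain as its interval of index [K]. *)
have /nbhs_ballP[rho /= rho0 sG] := oG _ (NG _ Ns).
pose t := Num.min b (s + rho / 2).
have st : s < t by rewrite lt_min sltb ltrDl divr_gt0.
have tb : t <= b by rewrite ge_min lexx.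
have tr : t <= s + rho / 2 by rewrite ge_min lexx orbT.
exists t; split => // eta eta0.
have [K [l [r [[fs1 fs2] hs]]]] := Qs _ eta0.
exists K.+1, (fun i => if (i < K)%N then l i else s),
  (fun i => if (i < K)%N then r i else t).
split; first split.
- move=> i; rewrite ltnS; case: ltnP => [iK _|_ _].
    by have [? ? ris ?] := fs1 _ iK; split => //; exact: le_trans (ltW st).
  split => //; first exact: ltW.
  move=> v /=; rewrite in_itv/= => /andP[sv vt]; apply: sG.
  by rewrite /ball/= distrC ger0_norm; lra.
- move=> i j /andP[ij]; rewrite ltnS leq_eqVlt => /orP[/eqP jK|jK].
    rewrite jK ltnn -jK ij; rewrite jK in ij.
    by have [] := fs1 _ ij.
  by rewrite jK (ltn_trans ij jK); apply: fs2; rewrite ij.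
- rewrite big_ord_recr/= ltnn.
  under eq_bigr do rewrite ltn_ord.
  have : e * (s - a) <= e * (t - a) by rewrite ler_pM2l//; lra.
  have := ler_norm (f t - f s).
  lra.
Unshelve. all: by end_near. Qed.

Lemma itv_null_opp (N : set R) : itv_null N -> itv_null [set t | N (- t)].
Proof.
move=> nN d /nN[G [oG NG Gd]]; exists [set t | G (- t)]; split.
- by apply: open_comp oG => t _; exact: oppr_continuous.
- by move=> t /NG.
- move=> K l r lr tr.
  rewrite (eq_bigr (fun i => - l i - - r i)); last by move=> i _; rewrite opprK addrC.
  apply: Gd => [i|i j _ _ [t /= [ti tj]]].
    have [li Gi] := lr i; rewrite lerN2; split => // t /=.
    rewrite in_itv/= lerNl lerNr => ti.
    by rewrite -[t]opprK; apply: Gi; rewrite /= in_itv/= andbC.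
  apply: tr => //; exists (- t); split; rewrite /= in_itv/=.
    by move: ti; rewrite in_itv/= ltrNl ltrNr andbC.
  by move: tj; rewrite in_itv/= ltrNl ltrNr andbC.
Qed.

Lemma abs_continuous_opp (V : normedModType R) a b (f : R -> V) :
  abs_continuous a b f -> abs_continuous (- b) (- a) (fun t => f (- t)).
Proof.
move=> acf e /acf[d d0 fd]; exists d => // K l r lr tr.
under eq_bigr do rewrite -[r _]opprK addrC.
under [in X in _ -> X]eq_bigr do rewrite distrC.
apply: (fd K (fun i => - r i) (fun i => - l i)).
  by move=> i; have [? ? ?] := lr i; split; [rewrite lerNr|rewrite lerN2|rewrite lerNl].
move=> i j _ _ [t /= [ti tj]].
apply: tr => //; exists (- t); split; rewrite /= in_itv/=.
  by move: ti; rewrite in_itv/= ltrNl ltrNr andbC.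
by move: tj; rewrite in_itv/= ltrNl ltrNr andbC.
Qed.

Lemma abs_continuous_sub (V : normedModType R) a b a' b' (f : R -> V) :
  a <= a' -> b' <= b -> abs_continuous a b f -> abs_continuous a' b' f.
Proof.
move=> aa' bb' acf e /acf[d d0 fd]; exists d => // K l r lr.
apply: fd => i; have [al ? rb] := lr i.
by split => //; [exact: le_trans al|exact: le_trans bb'].
Qed.

(* The bound on [f tau - f t] is one-sided, so it controls the growth of [f] to
   the right of [t] and that of its reflection to the left. *)
Lemma ac_dini_cst a b f : a <= b -> abs_continuous a b f ->
  (\forall t \ae (@lebesgue_measure R), a < t < b -> forall e, 0 < e ->
    \forall tau \near t, f tau - f t <= e * `|tau - t|) ->
  f b = f a.
Proof.
move=> ab acf fae.
(* The endpoints join the exceptional set: the hypothesis covers interior points only, while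
   [ac_dini_le] also asks about the left end, which is [a], or [- b] after reflection. *)
pose N := (~` [set t | a < t < b -> forall e, 0 < e ->
  \forall tau \near t, f tau - f t <= e * `|tau - t|] `|` [set a]) `|` [set b].
have nN : itv_null N.
  have n1 (c : R) : (@lebesgue_measure R).-negligible [set c].
    by exists [set c]; split => //; exact: lebesgue_measure_set1.
  by apply: negligible_itv_null; apply: negligibleU => //; exact: negligibleU.
have key t e : a <= t <= b -> ~ N t -> 0 < e ->
    \forall tau \near t, f tau - f t <= e * `|tau - t|.
  move=> /andP[at_ tb] /not_orP[/not_orP[/contrapT dt ta] tb'] e0.
  apply: dt => //; rewrite !lt_neqAle at_ tb !andbT.
  apply/andP; split; first by apply/eqP => ta'; apply: ta; rewrite /= ta'.
  exact/eqP.
apply/eqP; rewrite eq_le; apply/andP; split.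
  apply: (ac_dini_le ab acf nN) => t e /andP[at_ tb] Nt e0.
  near=> tau.
  have ttau : t < tau by near: tau; exact: nbhs_right_gt.
  rewrite -[tau - t]gtr0_norm ?subr_gt0//; near: tau.
  by apply: cvg_within; apply: key => //; rewrite at_ ltW.
have ba : - b <= - a by rewrite lerN2.
(* On [[- b, - a]] the reflected function gives the opposite inequality [f a <= f b]. *)
have := ac_dini_le ba (abs_continuous_opp acf) (itv_null_opp nN).
rewrite !opprK; apply => t e /andP[at_ tb] Nt e0.
have := key (- t) e; rewrite lerNr lerNl (ltW tb) at_ => /(_ isT Nt e0) H.
near=> tau.
have ttau : t < tau by near: tau; exact: nbhs_right_gt.
rewrite -[tau - t]gtr0_norm ?subr_gt0//.
have -> : `|tau - t| = `|- tau - - t| by rewrite -opprB normrN opprK addrC.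
near: tau; apply: cvg_within.
exact: (@oppr_continuous _ R t _ H).
Unshelve. all: by end_near. Qed.

End dini.

Section absolute_continuity.
Set Implicit Arguments.
Unset Strict Implicit.
Variables (R : realType) (a b : R).

(** The common source of the closure properties below: each reduces to a pointwise estimate of
    increments. [C] may have any sign, hence [|C| + 1] in the choice of [e']. *)
Lemma abs_continuous_dom (V V1 V2 : normedModType R) (f : R -> V)
    (g : R -> V1) (h : R -> V2) (C : R) :
  abs_continuous a b g -> abs_continuous a b h ->
  (forall s t, a <= s -> s <= t -> t <= b ->
    `|f t - f s| <= C * (`|g t - g s| + `|h t - h s|)) ->
  abs_continuous a b f.
Proof.
move=> acg ach fgh e e0.
pose e' := e / (2 * (`|C| + 1)).
have C0 : 0 < `|C| + 1 by rewrite ltr_wpDl.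
have e'0 : 0 < e' by rewrite divr_gt0// mulr_gt0.
have [d1 d10 gd] := acg _ e'0; have [d2 d20 hd] := ach _ e'0.
exists (Num.min d1 d2); first by rewrite lt_min d10.
move=> K l r lr tr; rewrite lt_min => /andP[/(gd K l r lr tr) sg /(hd K l r lr tr) sh].
apply: le_lt_trans
  (_ : (`|C| + 1) * (\sum_i `|g (r i) - g (l i)| + \sum_i `|h (r i) - h (l i)|) < e).
  rewrite -big_split mulr_sumr ler_sum//= => i _.
  have [al ? rb] := lr i; apply: le_trans (fgh _ _ _ _ _) _ => //.
  by rewrite ler_wpM2r ?addr_ge0// (le_trans (ler_norm _))// lerDl.
rewrite -ltr_pdivlMl//.
have -> : (`|C| + 1)^-1 * e = e' + e' by rewrite /e'; field; lra.
exact: ltrD.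
Qed.

Lemma abs_continuous_id : abs_continuous a b (@id R).
Proof.
move=> e e0; exists e => // K l r lr tr; apply: le_lt_trans.
by rewrite ler_sum// => i _; have [_ lri _] := lr i; rewrite ger0_norm// subr_ge0.
Qed.

(** By uniform continuity the norm grows by at most 1 over a step of length [d / 2], and finitely
    many such steps, truncated at [a], lead from any point back to [a]. *)
Lemma abs_continuous_bounded (V : normedModType R) (f : R -> V) :
  abs_continuous a b f ->
  exists2 M : R, 0 <= M & forall t, t \in `[a, b] -> `|f t| <= M.
Proof.
move=> /abs_continuous_unif /(_ _ ltr01)[d d0 fd].
have H k t : a <= t -> t <= b -> t - a <= k%:R * (d / 2) -> `|f t| <= `|f a| + k%:R.
  elim: k t => [|k IHk] t at_ tb tk.
    by have -> : t = a; [apply/eqP; rewrite eq_le at_ andbT; lra|rewrite addr0].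
  pose s := Num.max a (t - d / 2).
  have st : s <= t by rewrite ge_max at_ gerBl; lra.
  have ts : t - s < d.
    by have : t - d / 2 <= s; [rewrite le_max lexx orbT|lra].
  have as_ : a <= s by rewrite le_max lexx.
  have sk : s - a <= k%:R * (d / 2).
    have ? : 0 <= k%:R * (d / 2) by rewrite mulr_ge0//; lra.
    rewrite lerBlDr ge_max; apply/andP; split; first lra.
    by move: tk; rewrite -natr1 mulrDl mul1r; lra.
  have := IHk _ as_ (le_trans st tb) sk.
  have := fd _ _ as_ st tb ts.
  have := ler_normD (f t - f s) (f s); rewrite subrK -natr1; lra.
have [k kb] : exists k : nat, b - a <= k%:R * (d / 2).
  exists (Num.bound `|(b - a) / (d / 2)|); rewrite -ler_pdivrMr; last lra.
  by rewrite (le_trans (ler_norm _))// ltW// archi_boundP.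
exists (`|f a| + k%:R); first by rewrite addr_ge0.
move=> t /itvP tab; apply: H; rewrite ?tab//.
by apply: le_trans kb; rewrite lerB// tab.
Qed.

Lemma abs_continuous_continuous (V : normedModType R) (f : R -> V) t :
  abs_continuous a b f -> a < t < b -> {for t, continuous f}.
Proof.
move=> /abs_continuous_unif acf /andP[at_ tb].
apply/cvgrPdist_lt => e /acf[d d0 fd]; near=> s.
have as_ : a < s by near: s; exact: lt_nbhsr.
have sb : s < b by near: s; exact: lt_nbhsl.
have std : `|t - s| < d by near: s; exact: (@nbhsx_ballx R R t d d0).
have [st|/ltW ts] := leP s t.
  by apply: fd => //; rewrite ?ltW//; apply: le_lt_trans std; exact: ler_norm.
rewrite distrC; apply: fd => //; rewrite ?ltW//.
by apply: le_lt_trans std; rewrite distrC; exact: ler_norm.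
Unshelve. all: by end_near. Qed.

Lemma abs_continuousD (V : normedModType R) (f g : R -> V) :
  abs_continuous a b f -> abs_continuous a b g ->
  abs_continuous a b (fun t => f t + g t).
Proof.
move=> acf acg; apply: (abs_continuous_dom (C := 1) acf acg) => s t _ _ _.
by rewrite mul1r opprD addrACA ler_normD.
Qed.

Lemma abs_continuousM (f g : R -> R) :
  abs_continuous a b f -> abs_continuous a b g ->
  abs_continuous a b (fun t => f t * g t).
Proof.
move=> acf acg.
have [Mf Mf0 fM] := abs_continuous_bounded acf.
have [Mg Mg0 gM] := abs_continuous_bounded acg.
apply: (abs_continuous_dom (C := Mf + Mg) acf acg) => s t as_ st tb.
have -> : f t * g t - f s * g s = (f t - f s) * g t + f s * (g t - g s) by ring.
apply: le_trans (ler_normD _ _) _; rewrite !normrM.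
have gt : `|g t| <= Mg by apply: gM; rewrite in_itv/= tb (le_trans as_).
have fs : `|f s| <= Mf by apply: fM; rewrite in_itv/= as_ (le_trans st).
have := ler_wpM2l (normr_ge0 (f t - f s)) gt.
have := ler_wpM2r (normr_ge0 (g t - g s)) fs.
have := mulr_ge0 Mf0 (normr_ge0 (f t - f s)).
have := mulr_ge0 Mg0 (normr_ge0 (g t - g s)).
lra.
Qed.

Lemma abs_continuous_cst (V : normedModType R) (v : V) :
  abs_continuous a b (cst v).
Proof.
move=> e e0; exists 1 => // K l r _ _ _.
by rewrite big1// => i _; rewrite subrr normr0.
Qed.

Lemma abs_continuous_sum n (f : 'I_n -> R -> R) :
  (forall i, abs_continuous a b (f i)) ->
  abs_continuous a b (fun t => \sum_i f i t).
Proof.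
move=> acf; have -> : (fun t => \sum_i f i t) = \sum_i f i.
  by apply/funext => t; rewrite fct_sumE.
elim/big_ind : _ => //; [exact: abs_continuous_cst|exact: abs_continuousD].
Qed.

Lemma rV_norm_coord n (v : 'rV[R]_n) i : `|v 0 i| <= `|v|.
Proof.
rewrite [leRHS]/Num.Def.normr/= mx_normrE.
exact: (le_bigmax _ (fun ij => `|v ij.1 ij.2|) (0, i)).
Qed.

Lemma abs_continuous_coord n (f : R -> 'rV[R]_n) i :
  abs_continuous a b f -> abs_continuous a b (fun t => f t 0 i).
Proof.
move=> acf; apply: (abs_continuous_dom (C := 1) acf acf) => s t _ _ _.
have -> : f t 0 i - f s 0 i = (f t - f s) 0 i by rewrite !mxE.
by rewrite mul1r (le_trans (rV_norm_coord _ _))// lerDl.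
Qed.

Lemma abs_continuous_dotv n (f g : R -> 'rV[R]_n) :
  abs_continuous a b f -> abs_continuous a b g ->
  abs_continuous a b (fun t => dotv (f t) (g t)).
Proof.
move=> acf acg; apply: abs_continuous_sum => i.
by apply: abs_continuousM; exact: abs_continuous_coord.
Qed.

End absolute_continuity.

(** * Smooth functions on boxes and maxima over controls *)

Section smooth.
Set Implicit Arguments.
Unset Strict Implicit.
Variable R : realType.

Definition smooth (V W : normedModType R) (f : V -> W) : Prop :=
  forall p, differentiable f p /\ forall v, {for p, continuous ('D_v f)}.

Lemma C1_on_setT (V W : normedModType R) (f : V -> W) :
  C1_on setT f -> smooth f.
Proof.
move=> [G [g [_ TG fg sg]]].
have -> : f = g by apply/funext => p; exact: fg.
by move=> p; apply: sg; exact: TG.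
Qed.

Lemma smooth_coord (V : normedModType R) n (f : V -> 'rV[R]_n) i :
  smooth f -> smooth (fun p => f p 0 i).
Proof.
move=> sf p; split.
  apply: (@differentiable_comp _ _ _ _ f (fun M : 'rV[R]_n => M 0 i : R)).
    exact: (sf p).1.
  exact: differentiable_coord.
move=> v.
have -> : 'D_v (fun p => f p 0 i) = (fun M : 'rV[R]_n => M 0 i : R) \o 'D_v f.
  apply/funext => q /=; rewrite derive_mx ?mxE//.
  exact: diff_derivable (sf q).1.
apply: continuous_comp; first exact: (sf p).2.
exact: coord_continuous.
Qed.

Lemma is_derive_comp_diff (V W : normedModType R) (g : R -> V) (f : V -> W)
    (t : R) (w : V) :
  is_derive t (1 : R) g w -> differentiable f (g t) ->
  is_derive t (1 : R) (f \o g) ('d f (g t) w).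
Proof.
move=> [/derivable1_diffP dg gw] df.
have dfg : differentiable (f \o g) t by exact: differentiable_comp.
split; first exact/derivable1_diffP.
by rewrite deriveE// diff_comp//=; congr ('d f _ _); rewrite -gw deriveE.
Qed.

Lemma is_derive_line (V : normedModType R) (p w : V) (c : R) :
  is_derive c (1 : R) (fun c => p + c *: w) w.
Proof.
rewrite -[X in is_derive _ _ _ X]add0r; apply: is_deriveD.
have dl : is_diff c ( *:%R^~ w : R -> V) ( *:%R^~ w) by exact: is_diff_scalel.
split; first exact/derivable1_diffP.
by rewrite deriveE// diff_val scale1r.
Qed.

Variables n m : nat.
Local Notation Z := (R * 'rV[R]_n)%type.
Local Notation W := (Z * 'rV[R]_m)%type.

(** The norm of a product is the maximum of the norms, so the ball is a product of balls of the
    finite-dimensional factors. *)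
Lemma closed_ball_box_compact (M : R) : compact [set p : W | `|p| <= M].
Proof.
have cl (V : normedModType R) : closed [set v : V | `|v| <= M].
  have -> : [set v : V | `|v| <= M] = Num.norm @^-1` [set` `]-oo, M]].
    by apply/seteqP; split => v /=; rewrite in_itv.
  apply: closed_comp; last exact: interval_closed.
  by move=> v _; exact: norm_continuous.
have bd (V : normedModType R) : bounded_set [set v : V | `|v| <= M].
  by exists M; split=> [|e Me v vM]; [exact: num_real|exact: le_trans vM (ltW Me)].
have cR : compact [set v : R | `|v| <= M].
  have -> : [set v : R | `|v| <= M] = [set` `[- M, M]].
    by apply/seteqP; split => v /=; rewrite in_itv/= ler_norml.
  exact: segment_compact.
have cV k : compact [set v : 'rV[R]_k | `|v| <= M]
  by apply: bounded_closed_compact; [exact: bd|exact: cl].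
have -> : [set p : W | `|p| <= M] =
    ([set v : R | `|v| <= M] `*` [set v : 'rV[R]_n | `|v| <= M])
    `*` [set v : 'rV[R]_m | `|v| <= M].
  apply/seteqP; split => -[[t y] v]; rewrite /setX /= prod_normE/= ge_max prod_normE/= ge_max.
    by move=> /andP[/andP[? ?] ?].
  by move=> [[-> ->] ->].
by apply: compact_setX => //; exact: compact_setX.
Qed.

Lemma continuous_box_bounded (f : W -> R) (M : R) : continuous f ->
  exists2 C : R, 0 <= C & forall p, `|p| <= M -> `|f p| <= C.
Proof.
move=> cf.
have : compact (f @` [set p : W | `|p| <= M]).
  apply: continuous_compact; last exact: closed_ball_box_compact.
  exact: continuous_subspaceT.
move=> /compact_bounded[C [_ HC]]; exists (`|C| + 1); first by rewrite addr_ge0.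
move=> p pM; apply: (HC (`|C| + 1)); last by exists p.
by rewrite (le_lt_trans (ler_norm _))// ltrDl.
Qed.

(** Mean value theorem on the segment from [z'] to [z] with [v] frozen; by convexity the segment
    stays in the ball. Only directional derivatives are known to be continuous, so the bound is
    taken in each basis direction of [Z] and recombined by linearity of the differential. *)
Lemma smooth_lipschitz (f : W -> R) (M : R) : smooth f ->
  exists2 C : R, 0 <= C & forall z z' v, `|(z, v)| <= M -> `|(z', v)| <= M ->
    `|f (z, v) - f (z', v)| <= C * `|z - z'|.
Proof.
move=> sf.
pose D w := 'D_(w, 0) f : W -> R.
have cD w : continuous (D w) by move=> p; exact: (sf p).2.
have [C0 C00 HC0] := continuous_box_bounded M (cD (1, 0)).
have /choice[C HC] : forall i : 'I_n, exists c : R, 0 <= c /\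
    forall p, `|p| <= M -> `|D (0, delta_mx 0 i) p| <= c.
  by move=> i; have [c c0 Hc] := continuous_box_bounded M (cD (0, delta_mx 0 i)); exists c.
exists (C0 + \sum_i C i).
  by rewrite addr_ge0// sumr_ge0// => i _; have [] := HC i.
move=> z z' v zM z'M.
pose g (c : R) : W := ((z', v) + c *: (z - z', 0)).
have dg c : is_derive c (1 : R) g (z - z', 0) by exact: is_derive_line.
have dfg c : is_derive c (1 : R) (f \o g) (D (z - z') (g c)).
  rewrite /D deriveE; last exact: (sf _).1.
  by apply: is_derive_comp_diff => //; exact: (sf _).1.
have cfg : {within [set` `[0, 1]], continuous (f \o g)}.
  by apply: derivable_within_continuous => c _; have [] := dfg c.
have [c] := MVT_segment ler01 (fun c _ => dfg c) cfg.
rewrite in_itv/= => /andP[c0 c1].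
have -> : f (z, v) - f (z', v) = (f \o g) 1 - (f \o g) 0.
  by rewrite /g /= scale0r addr0 scale1r; congr (f (_, _) - _);
    rewrite /= ?addr0// addrC subrK.
move=> ->; rewrite subr0 mulr1.
have gM : `|g c| <= M.
  have -> : g c = (1 - c) *: (z', v) + c *: (z, v).
    rewrite /g; congr pair => /=.
      by rewrite scalerBr scalerBl scale1r -addrA; congr (_ + _); rewrite addrC.
    by rewrite scaler0 addr0 scalerBl scale1r subrK.
  rewrite (le_trans (ler_normD _ _))// !normrZ !ger0_norm; [|lra..].
  have : c * `|(z, v)| <= c * M by rewrite ler_wpM2l.
  have : (1 - c) * `|(z', v)| <= (1 - c) * M by rewrite ler_wpM2l//; lra.
  lra.
set w := z - z'.
have -> : D w (g c) = w.1 * D (1, 0) (g c) + \sum_i w.2 0 i * D (0, delta_mx 0 i) (g c).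
  rewrite /D !deriveE; try exact: (sf _).1.
  have -> : (w, 0) = w.1 *: ((1, 0), 0) + \sum_i w.2 0 i *: ((0, delta_mx 0 i), 0) :> W.
    have -> : \sum_i w.2 0 i *: ((0, delta_mx 0 i), 0) = ((0, w.2), 0) :> W.
      rewrite [in RHS](row_sum_delta w.2).
      elim/big_ind2 : _ => // [p v1 q v2 -> ->|i _].
        by congr pair; [congr pair|]; rewrite /= addr0.
      by congr pair; [congr pair|]; rewrite /= scaler0.
    by case: w => w1 w2; congr pair; [congr pair|]; rewrite /= ?scaler0 ?addr0 ?add0r//; exact/esym/mulr1.
  rewrite linearD linearZ linear_sum/=; congr (_ + _).
  by apply: eq_bigr => i _; rewrite linearZ deriveE//; exact: (sf _).1.
have wP : `|w.1| <= `|w| /\ `|w.2| <= `|w|.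
  by rewrite [in leRHS]prod_normE [X in _ /\ (_ <= X)]prod_normE !le_max !lexx orbT.
rewrite [leRHS]mulrDl mulr_suml (le_trans (ler_normD _ _))// lerD//.
  by rewrite normrM mulrC ler_pM//; [exact: HC0|exact: wP.1].
rewrite (le_trans (ler_norm_sum _ _ _))// ler_sum// => i _.
rewrite normrM mulrC ler_pM//; first exact: (HC i).2.
exact: le_trans (rV_norm_coord _ _) wP.2.
Qed.

Variables (c0 : R) (f0 : W -> R) (f : 'I_n -> W -> R).
Hypotheses (sf0 : smooth f0) (sf : forall i, smooth (f i)).
(** The Hamiltonian in coordinates: [z] is the pair of time and state, [c0] is the multiplier of the
    cost [f0], and the [f i] are the components of the dynamics. *)
Let h (z : Z) (v : 'rV[R]_m) (p : 'rV[R]_n) : R :=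
  c0 * f0 (z, v) + \sum_i p 0 i * f i (z, v).

(** The constant is uniform in [v], which lets the estimate pass to a supremum over controls.
    Splitting [p f - p' f'] as [p (f - f') + (p - p') f'] calls for a bound on [p] only. *)
Lemma linear_comb_lipschitz (M Mp : R) : exists C : R,
  forall z z' v p p', `|(z, v)| <= M -> `|(z', v)| <= M -> `|p| <= Mp ->
    `|h z v p - h z' v p'| <= C * (`|z - z'| + `|p - p'|).
Proof.
have [C0 C00 HC0] := smooth_lipschitz M sf0.
have /choice[C HC] : forall i : 'I_n, exists c : R, 0 <= c /\
    forall z z' v, `|(z, v)| <= M -> `|(z', v)| <= M ->
    `|f i (z, v) - f i (z', v)| <= c * `|z - z'|.
  by move=> i; have [c c0' Hc] := smooth_lipschitz M (sf i); exists c.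
have /choice[B HB] : forall i : 'I_n, exists c : R, 0 <= c /\
    forall p, `|p| <= M -> `|f i p| <= c.
  move=> i; have cfi : continuous (f i).
    by move=> p; apply: differentiable_continuous; exact: (sf i p).1.
  by have [c c0' Hc] := continuous_box_bounded M cfi; exists c.
exists (`|c0| * C0 + \sum_i (Mp * C i + B i)) => z z' v p p' zM z'M pM.
have -> : h z v p - h z' v p' = c0 * (f0 (z, v) - f0 (z', v)) +
    \sum_i (p 0 i * (f i (z, v) - f i (z', v)) + (p - p') 0 i * f i (z', v)).
  rewrite /h mulrBr opprD addrACA -sumrB; congr (_ + _).
  by apply: eq_bigr => i _; rewrite !mxE; ring.
have z0 := normr_ge0 (z - z'); have p0 := normr_ge0 (p - p').
rewrite mulrDl mulr_suml (le_trans (ler_normD _ _))// lerD//.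
  rewrite normrM -mulrA ler_wpM2l// (le_trans (HC0 _ _ _ zM z'M))//.
  by rewrite ler_wpM2l// lerDl.
rewrite (le_trans (ler_norm_sum _ _ _))// ler_sum// => i _.
have [C1 {}HC] := HC i; have [B0 {}HB] := HB i.
rewrite (le_trans (ler_normD _ _))// mulrDl !normrM lerD//.
  rewrite -mulrA ler_pM//; first exact: le_trans (rV_norm_coord _ _) pM.
  by rewrite (le_trans (HC _ _ _ zM z'M))// ler_wpM2l// lerDl.
rewrite mulrC ler_pM//; first exact: HB.
by rewrite (le_trans (rV_norm_coord _ _))// lerDr.
Qed.

(** Boundedness of [S] keeps all points [(z t, v)] in one ball, where the increments of [h] are
    dominated uniformly in [v]; a supremum inherits such a bound. *)
Lemma abs_continuous_max a b (z : R -> Z) (p : R -> 'rV[R]_n)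
    (S : set 'rV[R]_m) (B : R) :
  abs_continuous a b z -> abs_continuous a b p ->
  S !=set0 -> (forall v, S v -> `|v| <= B) ->
  exists hmax : R -> R, abs_continuous a b hmax /\
    forall t, t \in `[a, b] ->
      (forall v, S v -> h (z t) v (p t) <= hmax t) /\
      (forall c, (forall v, S v -> h (z t) v (p t) <= c) -> hmax t <= c).
Proof.
move=> acz acp [v0 Sv0] SB.
have [Mz Mz0 Hz] := abs_continuous_bounded acz.
have [Mp Mp0 Hp] := abs_continuous_bounded acp.
have cont (g : W -> R) : smooth g -> continuous g.
  by move=> sg q; apply: differentiable_continuous; exact: (sg q).1.
pose M := Num.max Mz B.
have zM t v : t \in `[a, b] -> S v -> `|(z t, v)| <= M.
  by move=> tab Sv; rewrite prod_normE/= ge_max !le_max Hz// SB// orbT.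
pose hS t := [set h (z t) v (p t) | v in S].
have hsup t : t \in `[a, b] -> has_sup (hS t).
  move=> tab; split; first by exists (h (z t) v0 (p t)), v0.
  have [C0 C00 HC0] := continuous_box_bounded M (cont _ sf0).
  have /choice[C HC] : forall i : 'I_n, exists c : R, 0 <= c /\
      forall p, `|p| <= M -> `|f i p| <= c.
    by move=> i; have [c ? Hc] := continuous_box_bounded M (cont _ (sf i)); exists c.
  exists (`|c0| * C0 + \sum_i `|p t 0 i| * C i) => _ [v Sv <-].
  apply: le_trans (ler_norm _) _; rewrite (le_trans (ler_normD _ _))// lerD//.
    by rewrite normrM ler_wpM2l// HC0// zM.
  rewrite (le_trans (ler_norm_sum _ _ _))// ler_sum// => i _.
  by rewrite normrM ler_wpM2l//; apply: (HC i).2; exact: zM.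
have ubS t v : t \in `[a, b] -> S v -> h (z t) v (p t) <= sup (hS t).
  by move=> /hsup[_ ub] Sv; apply: ub_le_sup ub _ _; exists v.
have leS t c : (forall v, S v -> h (z t) v (p t) <= c) -> sup (hS t) <= c.
  move=> hc; apply: ge_sup; first by exists (h (z t) v0 (p t)), v0.
  by move=> _ [v Sv <-]; exact: hc.
exists (fun t => sup (hS t)); split; last by move=> t tab; split=> *; [exact: ubS|exact: leS].
have [C HC] := linear_comb_lipschitz M Mp.
apply: (abs_continuous_dom (C := C) acz acp) => s t as_ st tb.
have sab : s \in `[a, b] by rewrite in_itv/= as_ (le_trans st).
have tab : t \in `[a, b] by rewrite in_itv/= tb (le_trans as_).
(* Each half bounds one supremum by the other plus the increment, comparing both times at the same
   [v]. *)
rewrite ler_distl; apply/andP; split.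
  rewrite lerBlDr; apply: leS => v Sv; rewrite -lerBlDl.
  apply: le_trans (lerB (lexx _) (ubS t v tab Sv)) _.
  apply: le_trans (ler_norm _) _; rewrite distrC.
  by apply: HC; [exact: zM|exact: zM|exact: Hp].
apply: leS => v Sv; rewrite -lerBlDl.
apply: le_trans (lerB (lexx _) (ubS s v sab Sv)) _.
apply: le_trans (ler_norm _) _.
by apply: HC; [exact: zM|exact: zM|exact: Hp].
Qed.

End smooth.

(** * Derivatives of curves *)

Section derivatives.
Set Implicit Arguments.
Unset Strict Implicit.
Variable R : realType.

Lemma is_derive_near (V : normedModType R) (f : R -> V) (t : R) (d : V) (e : R) :
  is_derive t (1 : R) f d -> 0 < e ->
  \forall s \near t, `|f s - f t - (s - t) *: d| <= e * `|s - t|.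
Proof.
move=> [df fd] e0; rewrite -{}fd.
move/cvgrPdist_le : df => /(_ _ e0)[/= r r0 H].
apply/nbhs_ballP; exists r => //= s; rewrite /ball/= distrC => tsr.
have [->|st] := eqVneq s t; first by rewrite !subrr scale0r subrr !normr0 mulr0.
have st0 : s - t != 0 by rewrite subr_eq0.
have := H (s - t); rewrite /= sub0r normrN => /(_ tsr st0).
rewrite -[lim _]/('D_1 f t) [(s - t) *: 1]mulr1 subrK => H'.
have -> : f s - f t - (s - t) *: 'D_1 f t =
    - ((s - t) *: ('D_1 f t - (s - t)^-1 *: (f s - f t))).
  by rewrite scalerBr scalerA mulfV// scale1r opprB.
by rewrite normrN normrZ [e * _]mulrC ler_wpM2l.
Qed.

Lemma is_derive_max (f : R -> R) (t d : R) : is_derive t (1 : R) f d ->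
  (\forall s \near t, f s <= f t) -> d = 0.
Proof.
move=> fd fmax; apply/eqP; apply: contraT => d0.
have e0 : 0 < `|d| / 2 by rewrite divr_gt0// normr_gt0.
have : \forall s \near t, f s <= f t /\
    `|f s - f t - (s - t) *: d| <= `|d| / 2 * `|s - t|.
  exact: filterI fmax (is_derive_near fd e0).
move=> /nbhs_ballP[r /= r0 H].
(* Moving by [r / 2] in the direction of the sign of [d] raises the linear part by [r / 2 * |d|],
   and the error takes back at most half of it, contradicting maximality. *)
have [] := H (t + Num.sg d * (r / 2)).
  rewrite /ball/= opprD addrA subrr sub0r normrN normrM normr_sg d0 mul1r.
  by rewrite gtr0_norm; lra.
rewrite [t + _]addrC addrK => f1; rewrite normrM normr_sg d0 mul1r gtr0_norm; last lra.
have -> : (Num.sg d * (r / 2)) *: d = (r / 2) * `|d|.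
  by rewrite [LHS]mulrAC -normrEsg mulrC.
rewrite ler_distl => /andP[+ _].
have : 0 < r / 2 * `|d| by rewrite mulr_gt0 ?normr_gt0//; lra.
lra.
Qed.

Lemma is_derive_dirP (V W : normedModType R) (f : V -> W) (x v : V) (d : W) :
  is_derive x v f d <-> is_derive (0 : R) (1 : R) (fun h => f (h *: v + x)) d.
Proof.
have E : 'D_v f x = 'D_1 (fun h : R => f (h *: v + x)) 0.
  rewrite /derive; set g1 := fun h => h^-1 *: _; set g2 := fun h => h^-1 *: _.
  suff -> : g1 = g2 by [].
  by apply/funext => h; rewrite /g1 /g2/= addr0 scale0r add0r [_%:A]mulr1.
split=> -[df fd]; split.
- exact: (@derivable1P _ _ _ f x v).1.
- by rewrite -E.
- exact: (@derivable1P _ _ _ f x v).2.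
- by rewrite E.
Qed.

Lemma is_derive_coord (V : normedModType R) n (f : V -> 'rV[R]_n) t v d i :
  is_derive t v f d -> is_derive t v (fun s => f s 0 i) (d 0 i).
Proof.
move=> [df fd]; split; first by have /derivable_mxP := df; exact.
by rewrite -fd derive_mx// mxE.
Qed.

Lemma is_derive_dotv n (f g : R -> 'rV[R]_n) t df dg :
  is_derive t (1 : R) f df -> is_derive t (1 : R) g dg ->
  is_derive t (1 : R) (fun s => dotv (f s) (g s)) (dotv df (g t) + dotv (f t) dg).
Proof.
move=> fd gd.
have -> : (fun s => dotv (f s) (g s)) =
    \sum_i ((fun s => f s 0 i) * (fun s => g s 0 i)).
  by apply/funext => s; rewrite fct_sumE.
rewrite /dotv -big_split/=; apply: is_derive_sum => i.
have := is_deriveM (is_derive_coord i fd) (is_derive_coord i gd).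
by move=> /is_derive_eq; apply; rewrite addrC; congr (_ + _); rewrite [LHS]mulrC.
Qed.

(** Once the derivative exists, a single sequence tending to 0 determines it. The value [v] need not
    be given as [B 0]: continuity of [B] identifies the two, and the difference quotients then tend
    to 0. *)
Lemma is_derive_seq0 (B : R -> R) (d v : R) (o : R -> R) :
  is_derive (0 : R) (1 : R) B d ->
  (harmonic j)^-1 * o (harmonic j) @[j --> \oo] --> (0 : R) ->
  (\forall j \near \oo, B (harmonic j) = v + o (harmonic j)) ->
  d = 0.
Proof.
move=> Bd oB BE.
have h0 : @harmonic R j @[j --> \oo] --> (0 : R) by exact: cvg_harmonic.
have o0 : o (harmonic j) @[j --> \oo] --> (0 : R).
  have -> : (fun j => o (harmonic j)) =
      (fun j => harmonic j * ((harmonic j)^-1 * o (harmonic j))).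
    by apply/funext => j; rewrite mulVKf// gt_eqF// harmonic_gt0.
  by rewrite -[X in _ --> X](mulr0 0); apply: cvgM.
have cB : {for 0, continuous B}.
  by apply: differentiable_continuous; apply/derivable1_diffP; case: Bd.
have B0 : B (harmonic j) @[j --> \oo] --> B 0 by exact: cvg_comp h0 cB.
have Bv : B (harmonic j) @[j --> \oo] --> v.
  have : v + o (harmonic j) @[j --> \oo] --> v + 0 by apply: cvgD => //; exact: cvg_cst.
  rewrite addr0; apply: cvg_trans; apply: near_eq_cvg.
  by apply: filterS BE => j ->.
have E : B 0 = v by exact: (cvg_unique _ B0 Bv).
apply/eqP; rewrite -normr_le0; apply/ler_addgt0Pr => e e0; rewrite add0r.
have e20 : 0 < e / 2 by rewrite divr_gt0.
have Bn := is_derive_near Bd e20.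
have {}Bn : \forall j \near \oo,
    `|B (harmonic j) - B 0 - (@harmonic R j - 0) *: d| <= e / 2 * `|@harmonic R j - 0|.
  exact: (h0 _ Bn).
move/cvgrPdist_le : oB => /(_ _ e20) oB.
have [j [[Bj oj] Ej]] := filter_ex (filterI (filterI Bn oB) BE).
have hj : 0 < @harmonic R j by rewrite harmonic_gt0.
move: Bj; rewrite Ej E [v + _]addrC addrK !subr0 (gtr0_norm hj) => H1.
move: oj; rewrite sub0r normrN normrM normfV (gtr0_norm hj) ler_pdivrMl// => H2.
have : `|@harmonic R j *: d| <= e * harmonic j.
  have := ler_normB (o (harmonic j)) (o (harmonic j) - @harmonic R j *: d).
  by rewrite opprB addrC subrK; lra.
by rewrite normrZ gtr0_norm// mulrC ler_pM2r.
Qed.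

End derivatives.

(** * Constancy from a majorant *)

Section almost_everywhere.
Set Implicit Arguments.
Unset Strict Implicit.
Variable R : realType.
Local Notation mu := (@lebesgue_measure R).

Lemma lebesgue_aeS (P Q : R -> Prop) : (forall t, P t -> Q t) ->
  (\forall t \ae mu, P t) -> \forall t \ae mu, Q t.
Proof. by move=> PQ; apply: (@filterS _ _ (ae_filter_ringOfSetsType mu)). Qed.

Lemma lebesgue_aeI (P Q : R -> Prop) : (\forall t \ae mu, P t) ->
  (\forall t \ae mu, Q t) -> \forall t \ae mu, P t /\ Q t.
Proof. exact: (@filterI _ _ (ae_filter_ringOfSetsType mu)). Qed.

End almost_everywhere.

Section majorant.
Set Implicit Arguments.
Unset Strict Implicit.
Variables (R : realType) (a b : R).
Local Notation mu := (@lebesgue_measure R).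

(* [g] stands for the Hamiltonian with the control frozen at its value at [t]. *)
Definition touches_below (hmax A th : R -> R) (t : R) : Prop :=
  exists g : R -> R, [/\ g t = hmax t, forall s, s \in `[a, b] -> g s <= hmax s,
    {for t, continuous g}, derivable th t 1 &
    is_derive t (1 : R) (fun s => A s - g s * th s) 0].

(** The same [g] and [hmax] serve, so the case of negative [th] reduces to that of positive [th]. *)
Lemma touches_belowN hmax A th t :
  touches_below hmax A th t -> touches_below hmax (\- A) (\- th) t.
Proof.
move=> [g [gt gle cg dth dB]]; exists g; split => //; first exact: derivableN.
have -> : (fun s => (\- A) s - g s * (\- th) s) = - (fun s => A s - g s * th s).
  by apply/funext => s; rewrite /= mulrN opprD.
by rewrite -[0]oppr0; exact: is_deriveN.
Qed.

Variables (hmax : R -> R).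
Hypothesis ach : abs_continuous a b hmax.

(** For positive [th] the inequality [g <= hmax] gives [A - hmax * th <= A - g * th], with equality
    at [t]. The right side has derivative 0 there, so the left side has the one-sided bound that
    [ac_dini_cst] requires. *)
Lemma majorant_cst_pos (A th : R -> R) c d :
  abs_continuous a b A -> abs_continuous a b th ->
  (\forall t \ae mu, a < t < b -> touches_below hmax A th t) ->
  a <= c -> c <= d -> d <= b -> (forall t, c <= t <= d -> 0 < th t) ->
  A d - hmax d * th d = A c - hmax c * th c.
Proof.
move=> acA acth tb ac cd db th0.
pose f t := A t - hmax t * th t.
have acf : abs_continuous a b f.
  apply: abs_continuousD => //.
  have -> : (fun t => - (hmax t * th t)) = (fun t => - 1 * (hmax t * th t)).
    by apply/funext => t; rewrite mulN1r.
  by apply: abs_continuousM; [exact: abs_continuous_cst|exact: abs_continuousM].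
apply: (ac_dini_cst cd (abs_continuous_sub ac db acf)).
apply: lebesgue_aeS tb => t + /andP[ct td] e e0.
have atb : a < t < b by rewrite (le_lt_trans ac ct) (lt_le_trans td db).
move=> /(_ atb)[g [gt gle cg dth dB]].
near=> s.
have cs : c < s by near: s; exact: lt_nbhsr.
have sd : s < d by near: s; exact: lt_nbhsl.
have : `|A s - g s * th s - (A t - g t * th t) - (s - t) *: 0| <= e * `|s - t|.
  by near: s; exact: is_derive_near.
rewrite scaler0 subr0 => /(le_trans (ler_norm _)); apply: le_trans.
rewrite /f -gt lerB// lerB// ler_wpM2r//; first by apply/ltW/th0; rewrite !ltW.
by apply: gle; rewrite in_itv/= (le_trans ac (ltW cs)) (le_trans (ltW sd) db).
Unshelve. all: by end_near. Qed.

(* Where [th] does not vanish, [A - hmax * th] is locally constant; where it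
   vanishes, continuity of [hmax] alone gives the derivative of the product. In
   this way differentiability of [hmax] is not required. *)
Lemma majorant_cst (A th : R -> R) :
  abs_continuous a b A -> abs_continuous a b th ->
  (\forall t \ae mu, a < t < b -> touches_below hmax A th t) ->
  forall t, t \in `[a, b] -> A t - hmax t * th t = A a - hmax a * th a.
Proof.
move=> acA acth tb t1; rewrite in_itv/= => /andP[at1 t1b].
pose f t := A t - hmax t * th t.
have acN (g : R -> R) : abs_continuous a b g -> abs_continuous a b (\- g).
  move=> acg; have -> : \- g = (fun t => - 1 * g t).
    by apply/funext => t; rewrite mulN1r.
  by apply: abs_continuousM => //; exact: abs_continuous_cst.
have acf : abs_continuous a b f.
  by apply: abs_continuousD => //; apply: acN; exact: abs_continuousM.
(* [sg] encodes the sign of [th]; for [sg = true] the positive case is applied to [\- A] and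
   [\- th]. *)
have cst_sign c d (sg : bool) : a <= c -> c <= d -> d <= b ->
    (forall t, c <= t <= d -> 0 < (-1) ^+ sg * th t) -> f d = f c.
  case: sg; rewrite ?expr1 ?expr0 => ac cd db th0.
    have := majorant_cst_pos (acN _ acA) (acN _ acth) _ ac cd db.
    rewrite /f /= => H; apply: oppr_inj; rewrite !opprB.
    have := H; rewrite !mulrN !opprK ![- A _ + _]addrC; apply.
      by apply: lebesgue_aeS tb => t H' /H' /touches_belowN.
    by move=> t /th0; rewrite mulN1r.
  apply: (majorant_cst_pos acA acth tb ac cd db) => t /th0.
  by rewrite mul1r.
apply: (ac_dini_cst at1 (abs_continuous_sub (lexx a) t1b acf)).
apply: lebesgue_aeS tb => t + /andP[at_ tt1] e e0.
have tb : t < b by exact: lt_le_trans t1b.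
have atb : a < t < b by rewrite at_.
move=> /(_ atb)[g [gt gle cg dth dB]].
have cth : {for t, continuous th}.
  by apply: differentiable_continuous; exact/derivable1_diffP.
have [th0|thn0] := eqVneq (th t) 0; last first.
  have [sg sgt] : exists sg : bool, 0 < (-1) ^+ sg * th t.
    have [tn|tp|/eqP] := ltgtP (th t) 0; last by rewrite (negbTE thn0).
      by exists true; rewrite expr1 mulN1r oppr_gt0.
    by exists false; rewrite expr0 mul1r.
  have : \forall s \near t, a < s < b /\ 0 < (-1) ^+ sg * th s.
    have csg : {for t, continuous (fun s => (-1) ^+ sg * th s)}.
      by apply: cvgM => //; exact: cvg_cst.
    near=> s; split.
      by apply/andP; split; near: s; [exact: lt_nbhsr|exact: lt_nbhsl].
    by near: s; exact: (cvgr_gt _ csg).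
  move=> /nbhs_ballP[r /= r0 H]; apply/nbhs_ballP; exists r => //= s tsr.
  suff -> : f s = f t by rewrite subrr mulr_ge0// ltW.
  have [/andP[as_ sb] _] := H _ tsr.
  move: tsr; rewrite /ball/= ltr_distl => /andP[ts1 ts2].
  have [st|/ltW ts] := leP s t.
    apply/esym/(cst_sign _ _ sg) => //; rewrite ?ltW// => v /andP[sv vt].
    by apply: (H _ _).2; rewrite /ball/= ger0_norm; lra.
  apply/(cst_sign _ _ sg) => //; rewrite ?ltW// => v /andP[tv vs].
  by apply: (H _ _).2; rewrite /ball/= distrC ger0_norm; lra.
have e20 : 0 < e / 2 by rewrite divr_gt0.
(* Near its zero [t], [th] is at most [K * |s - t|], the [+ 1] absorbing an error of tolerance 1.
   Since [g - hmax] tends to 0, keeping it within [e / 2 / K] makes [(g - hmax) * th] at most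
   [e / 2 * |s - t|]. *)
pose K := `|'D_1 th t| + 1.
have K0 : 0 < K by rewrite ltr_wpDl.
have e3 : 0 < e / 2 / K by rewrite divr_gt0.
have chm : {for t, continuous hmax} by exact: abs_continuous_continuous ach atb.
near=> s.
have Bs : `|A s - g s * th s - (A t - g t * th t) - (s - t) *: 0| <= e / 2 * `|s - t|.
  by near: s; exact: is_derive_near.
have ths : `|th s - th t - (s - t) *: 'D_1 th t| <= 1 * `|s - t|.
  by near: s; apply: is_derive_near => //; exact: derivableP.
have gs : `|(g s - hmax s)| <= e / 2 / K.
  near: s; have : (g s - hmax s) @[s --> t] --> g t - hmax t by exact: cvgB.
  rewrite gt subrr => /cvgrPdist_le /(_ _ e3); apply: filterS => s.
  by rewrite sub0r normrN.
have {}ths : `|th s| <= K * `|s - t|.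
  move: ths; rewrite th0 subr0 mul1r => ths.
  have := ler_normD (th s - (s - t) *: 'D_1 th t) ((s - t) *: 'D_1 th t).
  by rewrite subrK normrZ /K mulrDl mul1r [`|s - t| * _]mulrC; lra.
have -> : f s - f t = (A s - g s * th s - (A t - g t * th t)) + (g s - hmax s) * th s.
  by rewrite /f th0 !mulr0; ring.
rewrite scaler0 subr0 in Bs.
have : (g s - hmax s) * th s <= e / 2 * `|s - t|.
  apply: le_trans (ler_norm _) _; rewrite normrM.
  apply: le_trans (ler_pM _ _ gs ths) _ => //.
  by rewrite mulrA divfK// gt_eqF.
have := ler_norm (A s - g s * th s - (A t - g t * th t)).
lra.
Unshelve. all: by end_near. Qed.

End majorant.

(** * Absolutely continuous representatives and [ddt] *)

Section representatives.
Set Implicit Arguments.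
Unset Strict Implicit.
Variables (R : realType) (a b : R).
Local Notation mu := (@lebesgue_measure R).

(** Otherwise the interval would be null, although its measure is [d - c > 0]. *)
Lemma ae_itv_exists (Q : R -> Prop) c d : c < d ->
  (\forall t \ae mu, Q t) -> exists2 t, c < t < d & Q t.
Proof.
move=> cd aeQ; apply: contrapT => nQ.
have : (mu [set` `]c, d[] = 0)%E.
  apply/eqP; rewrite -measure_le0; case: aeQ => N [mN N0 QN].
  rewrite -[leRHS]N0; apply: le_measure; rewrite ?inE//.
  move=> t /=; rewrite in_itv/= => tcd; apply: QN => /= Qt.
  by apply: nQ; exists t.
rewrite lebesgue_measure_itv/= lte_fin cd => -[/eqP].
by rewrite subr_eq0 gt_eqF.
Qed.

Lemma ac_repP (V : normedModType R) (f : R -> V) :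
  ae_abs_continuous a b f -> is_ac_rep a b f (ac_rep a b f).
Proof. by move=> [g fg]; apply: xgetPex; exists g. Qed.

(** Two continuous functions that differ at [t] differ on a whole ball, where equality almost
    everywhere must hold somewhere. Beyond [[a, b]] the representative is arbitrary, so two-sided
    continuity is available at interior points only. *)
Lemma ac_rep_eq (V : normedModType R) (f g : R -> V) :
  abs_continuous a b g -> (forall t, t \in `[a, b] -> f t = g t) ->
  forall t, a < t < b -> ac_rep a b f t = g t.
Proof.
move=> acg fg t tab.
have [] : is_ac_rep a b f (ac_rep a b f).
  by apply: ac_repP; exists g; split => //; apply: aeW => s; exact: fg.
set h := ac_rep a b f => ach fh.
apply: contrapT => /eqP hg.
have ch : {for t, continuous h} by exact: abs_continuous_continuous ach tab.
have cg : {for t, continuous g} by exact: abs_continuous_continuous acg tab.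
have : \forall s \near t, h s - g s != 0 /\ a < s < b.
  have chg : {for t, continuous (fun s => h s - g s)} by exact: cvgB.
  have hg0 : h t - g t != 0 by rewrite subr_eq0.
  move: tab => /andP[at_ tb]; near=> s; split.
    by near: s; exact: (cvgr_neq0 (h t - g t) chg hg0).
  by apply/andP; split; near: s; [exact: lt_nbhsr|exact: lt_nbhsl].
move=> /nbhs_ballP[r /= r0 H].
have [|s /andP[s1 s2] sfh] := @ae_itv_exists _ (t - r) (t + r) _ fh; first lra.
have [|+ /andP[as_ sb]] := H s; first by rewrite /ball/= ltr_distlC s1.
have sab : s \in `[a, b] by rewrite in_itv/= !ltW.
by rewrite -sfh// fg// subrr eqxx.
Unshelve. all: by end_near. Qed.

Lemma is_derive_ddt (V : normedModType R) (f : R -> V) t :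
  derivable (ac_rep a b f) t 1 ->
  is_derive t (1 : R) (ac_rep a b f) (ddt a b f t).
Proof. by move=> df; split => //; rewrite /ddt derive1E. Qed.

Lemma derive1_near_eq (V : normedModType R) (f g : R -> V) (t : R) (d : V) :
  (\forall s \near t, f s = g s) -> is_derive t (1 : R) g d -> derive1 f t = d.
Proof.
move=> fg [_ <-]; rewrite derive1E; exact: near_eq_derive.
Qed.

Lemma ddt_eq (V : normedModType R) (f g : R -> V) (t : R) (d : V) :
  abs_continuous a b g -> (forall s, s \in `[a, b] -> f s = g s) ->
  a < t < b -> is_derive t (1 : R) g d -> ddt a b f t = d.
Proof.
move=> acg fg /andP[at_ tb]; apply: derive1_near_eq; near=> s.
apply: ac_rep_eq => //.
by apply/andP; split; near: s; [exact: lt_nbhsr|exact: lt_nbhsl].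
Unshelve. all: by end_near. Qed.

End representatives.

(** * Conservation along extremals *)

Section families.
Set Implicit Arguments.
Unset Strict Implicit.
Variable R : realType.

Lemma is_derive_dir0 (V W : normedModType R) (f : V -> W) (v : V) (d : W) :
  is_derive 0 v f d -> is_derive (0 : R) (1 : R) (fun h => f (h *: v)) d.
Proof.
move=> /is_derive_dirP.
by under [X in is_derive _ _ X _ -> _]eq_fun do rewrite addr0.
Qed.

Lemma is_derive_pair (V W : normedModType R) (f : R -> V) (g : R -> W) t df dg :
  is_derive t (1 : R) f df -> is_derive t (1 : R) g dg ->
  is_derive t (1 : R) (fun s => (f s, g s)) (df, dg).
Proof.
move=> [/derivable1_diffP cf <-] [/derivable1_diffP cg <-].
have cfg : differentiable (fun s => (f s, g s)) t by exact: differentiable_pair.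
split; first exact/derivable1_diffP.
by rewrite !deriveE// diff_pair.
Qed.

Lemma enorm_basis r (k : 'I_r) (c : R) : enorm (c *: basisv R k) = `|c|.
Proof.
rewrite /enorm (bigD1 k)//= big1 ?addr0 => [|i ik].
  by rewrite /basisv !mxE !eqxx mulr1 sqrtr_sqr.
by rewrite /basisv !mxE (negbTE ik) andbF mulr0 expr0n.
Qed.

Lemma cvg_basis_harmonic r (k : 'I_r) :
  @harmonic R j *: basisv R k @[j --> \oo] --> (0 : 'rV[R]_r)^'.
Proof.
have h0 : @harmonic R j *: basisv R k @[j --> \oo] --> (0 : 'rV[R]_r).
  rewrite -[X in _ --> X](scale0r (basisv R k)).
  by apply: cvgZr_tmp; exact: cvg_harmonic.
move=> Q Q0.
have : \forall j \near \oo, @harmonic R j *: basisv R k != 0 ->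
    Q (@harmonic R j *: basisv R k) by exact: (h0 _ Q0).
apply: filterS => j /= H; apply: H.
apply/eqP => /matrixP/(_ 0 k); rewrite /basisv !mxE !eqxx mulr1 => /eqP.
by rewrite gt_eqF// harmonic_gt0.
Qed.

Lemma little_o_harmonic (V : normedModType R) r (o : 'rV[R]_r -> V) (k : 'I_r) :
  little_o o ->
  (harmonic j)^-1 *: o (harmonic j *: basisv R k) @[j --> \oo] --> (0 : V).
Proof.
move=> lo; have := cvg_comp _ _ (cvg_basis_harmonic k) lo.
apply: cvg_trans; apply: near_eq_cvg; apply: nearW => j /=.
by rewrite enorm_basis gtr0_norm// harmonic_gt0.
Qed.

Lemma dotvD k (p v w : 'rV[R]_k) : dotv p (v + w) = dotv p v + dotv p w.
Proof.
rewrite /dotv -big_split; apply: eq_bigr => i _.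
by rewrite !mxE mulrDr.
Qed.

Lemma dotvZ k (p v : 'rV[R]_k) (c : R) : dotv p (c *: v) = c * dotv p v.
Proof.
by rewrite /dotv mulr_sumr; apply: eq_bigr => i _; rewrite !mxE mulrCA.
Qed.

Lemma dotvC k (p v : 'rV[R]_k) : dotv p v = dotv v p.
Proof. by apply: eq_bigr => i _; rewrite mulrC. Qed.

Lemma dotv0 k (p : 'rV[R]_k) : dotv p 0 = 0.
Proof. by rewrite -(scale0r 0) dotvZ mul0r. Qed.

Lemma dotvN k (p v : 'rV[R]_k) : dotv p (- v) = - dotv p v.
Proof. by rewrite -scaleN1r dotvZ mulN1r. Qed.

Variables (n m r : nat) (P : control_problem R n m).
Local Notation a := (cp_a P).
Local Notation b := (cp_b P).

(** The domain of the family need not be open, but the line in the direction of [s_k] stays in it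
    for [|c| < eps]. There [G] coincides with its smooth extension, which supplies the
    derivative. *)
Lemma C1_family_is_derive (V : normedModType R) eps (G : param_family R n m r V)
    t y v k : C1_family P eps G -> 0 < eps -> t \in `[a, b] -> cp_Omega P v ->
  is_derive (0 : R) (1 : R) (fun c => G t y v (c *: basisv R k))
    ('D_(basisv R k) (fun s => G t y v s) 0).
Proof.
move=> [Q [g [oQ AQ Gg sg]]] eps0 tab Ov.
pose p0 : R * 'rV[R]_n * 'rV[R]_m * 'rV[R]_r := (t, y, v, 0).
pose w : R * 'rV[R]_n * 'rV[R]_m * 'rV[R]_r := (0, basisv R k).
have line c : p0 + c *: w = (t, y, v, c *: basisv R k).
  by rewrite /p0 /w; congr pair; rewrite /= ?scaler0 ?addr0 ?add0r.
have dom c : `|c| < eps -> family_dom P eps (p0 + c *: w).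
  by move=> ce; rewrite line /family_dom/= enorm_basis.
have dgl : differentiable g (p0 + 0 *: w).
  by apply: (sg _ _).1; apply/AQ/dom; rewrite normr0.
have /near_eq_is_derive : \forall c \near (0 : R),
    (g \o (fun c => p0 + c *: w)) c = G t y v (c *: basisv R k).
  apply/nbhs_ballP; exists eps => //= c; rewrite /ball/= sub0r normrN => ce.
  by rewrite -Gg ?line//; rewrite -line; exact: dom.
move=> /(_ _ _ (is_derive_comp_diff (is_derive_line p0 w 0) dgl)).
set d := 'd g _ _ => Gd.
suff : is_derive 0 (basisv R k) (fun s => G t y v s) d by move=> [_ ->].
apply/is_derive_dirP.
by under [X in is_derive _ _ X _]eq_fun do rewrite addr0.
Qed.

Local Notation W := (R * 'rV[R]_n * 'rV[R]_m)%type.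
Let Lw (q : W) : R := cp_L P q.1.1 q.1.2 q.2.
Let phiw (q : W) : 'rV[R]_n := cp_phi P q.1.1 q.1.2 q.2.
Variable psi0 : R.

(** The differential of the Hamiltonian in [q = (t, x, u)], with both multipliers frozen. Kept as
    one linear map, it treats the variations of [T], [X] and [U] together. *)
Definition diff_hamiltonian (q : W) (p : 'rV[R]_n) (w : W) : R :=
  psi0 * 'd Lw q w + dotv p ('d phiw q w).

Lemma diff_hamiltonianD q p w w' :
  diff_hamiltonian q p (w + w') = diff_hamiltonian q p w + diff_hamiltonian q p w'.
Proof. by rewrite /diff_hamiltonian !linearD dotvD mulrDr addrACA. Qed.

Lemma diff_hamiltonianZ q p c w :
  diff_hamiltonian q p (c *: w) = c * diff_hamiltonian q p w.
Proof. by rewrite /diff_hamiltonian !linearZ dotvZ mulrDr mulrCA. Qed.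

Lemma diff_hamiltonian0 q p : diff_hamiltonian q p 0 = 0.
Proof. by rewrite /diff_hamiltonian !linear0 dotv0 mulr0 addr0. Qed.

Lemma is_derive_hamiltonian (gam : R -> W) (psi : R -> 'rV[R]_n) t w dpsi :
  is_derive t (1 : R) gam w -> is_derive t (1 : R) psi dpsi ->
  is_derive t (1 : R)
    (fun s => hamiltonian P (gam s).1.1 (gam s).1.2 (gam s).2 psi0 (psi s))
    (diff_hamiltonian (gam t) (psi t) w + dotv dpsi (phiw (gam t))).
Proof.
move=> dgam dps.
have dL := is_derive_comp_diff dgam (C1_on_setT (cp_L_C1 P) _).1.
have dphi := is_derive_comp_diff dgam (C1_on_setT (cp_phi_C1 P) _).1.
have := is_deriveD (is_deriveZ psi0 dL) (is_derive_dotv dps dphi).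
move=> /is_derive_eq; apply.
by rewrite /diff_hamiltonian [dotv dpsi _ + _]addrC addrA.
Qed.

(** This turns the first Hamiltonian equation into the control system, whence extremals are
    admissible. *)
Lemma grad_hamiltonian_p t y v p :
  grad (fun p => hamiltonian P t y v psi0 p) p = cp_phi P t y v.
Proof.
apply/rowP => i; rewrite !mxE.
have dline : is_derive (0 : R) (1 : R) (fun h => h *: basisv R i + p) (basisv R i).
  by under eq_fun do rewrite addrC; exact: is_derive_line.
have cst : is_derive (0 : R) (1 : R) (fun=> (t, y, v) : W) 0 by exact: is_derive_cst.
have := is_derive_hamiltonian cst dline.
move=> /(@is_derive_dirP _ _ _ (fun p => hamiltonian P t y v psi0 p))[_ ->].
rewrite /diff_hamiltonian !linear0 dotv0 mulr0 !add0r /dotv (bigD1 i)//= big1 ?addr0.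
  by rewrite mxE !eqxx mul1r.
by move=> j ji; rewrite mxE (negbTE ji) andbF mul0r.
Qed.

(** The adjoint equation is stated with a gradient in coordinates; this is its passage to
    differentials, by expanding [w] in the basis. *)
Lemma dotv_grad_hamiltonian_y t y v p w :
  dotv (grad (fun y => hamiltonian P t y v psi0 p) y) w =
  diff_hamiltonian (t, y, v) p (0, w, 0).
Proof.
have gradE i : grad (fun y => hamiltonian P t y v psi0 p) y 0 i =
    diff_hamiltonian (t, y, v) p (0, basisv R i, 0).
  rewrite mxE.
  have dline : is_derive (0 : R) (1 : R)
      (fun h => (t, h *: basisv R i + y, v) : W) (0, basisv R i, 0).
    have dl : is_derive (0 : R) (1 : R) (fun h => h *: basisv R i + y) (basisv R i).
      by under eq_fun do rewrite addrC; exact: is_derive_line.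
    by apply: is_derive_pair; exact: is_derive_pair.
  have cst : is_derive (0 : R) (1 : R) (fun=> p) 0 by exact: is_derive_cst.
  have := is_derive_hamiltonian dline cst.
  rewrite /= => /(@is_derive_dirP _ _ _ (fun y => hamiltonian P t y v psi0 p))[_ ->].
  by rewrite scale0r add0r dotvC dotv0 addr0.
rewrite /dotv; under eq_bigr do rewrite gradE mulrC -diff_hamiltonianZ.
have <- : \sum_i w 0 i *: (0, basisv R i, 0) = (0, w, 0) :> W.
  rewrite [in RHS](row_sum_delta w).
  elim/big_ind2 : _ => // [p1 v1 p2 v2 -> ->|i _].
    by congr pair; [congr pair|]; rewrite /= addr0.
  by congr pair; [congr pair|]; rewrite /= scaler0.
elim/big_ind2 : _ => // [|p1 v1 p2 v2 -> ->]; last by rewrite diff_hamiltonianD.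
exact/esym/diff_hamiltonian0.
Qed.

(* For a fixed [t] the identities are available only for countably many [s],
   their exceptional null sets depending on [s]: hence the sequence. *)
Lemma invariance_derivative (q : W) (p : 'rV[R]_n) (gam : R -> W)
    (tau Ft : R -> R) (Xt : R -> 'rV[R]_n) (oL : R -> R) (oX : R -> 'rV[R]_n)
    w dtau dF dX :
  gam 0 = q -> tau 0 = 1 ->
  is_derive (0 : R) (1 : R) gam w -> is_derive (0 : R) (1 : R) tau dtau ->
  is_derive (0 : R) (1 : R) Ft dF -> is_derive (0 : R) (1 : R) Xt dX ->
  (harmonic j)^-1 *: oL (harmonic j) @[j --> \oo] --> (0 : R) ->
  (harmonic j)^-1 *: oX (harmonic j) @[j --> \oo] --> (0 : 'rV[R]_n) ->
  (\forall j \near \oo, let c := harmonic j in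
    Lw q + Ft c + oL c = Lw (gam c) * tau c /\
    Xt c + oX c = tau c *: phiw (gam c)) ->
  psi0 * dF + dotv p dX =
    diff_hamiltonian q p w + hamiltonian P q.1.1 q.1.2 q.2 psi0 p * dtau.
Proof.
move=> gq tau1 dgam dt dFt dXt oL0 oX0 id.
(* The two identities combined with weights [psi0] and [p]: along the sequence they make [B] equal
   to [psi0 * Lw q] up to a remainder, so its derivative at 0, which is the difference of the two
   sides of the goal, vanishes. *)
pose B := (fun c => hamiltonian P (gam c).1.1 (gam c).1.2 (gam c).2 psi0 p) * tau
  - (psi0 \*: Ft + fun c => dotv p (Xt c)).
have cst : is_derive (0 : R) (1 : R) (fun=> p) 0 by exact: is_derive_cst.
have dB : is_derive (0 : R) (1 : R) B
    (hamiltonian P q.1.1 q.1.2 q.2 psi0 p * dtau + diff_hamiltonian q p w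
      - (psi0 * dF + dotv p dX)).
  have := is_deriveB (is_deriveM (is_derive_hamiltonian dgam cst) dt)
    (is_deriveD (is_deriveZ psi0 dFt) (is_derive_dotv cst dXt)).
  move=> /is_derive_eq; apply.
  by rewrite gq tau1 scale1r dotvC dotv0 addr0 [dotv 0 _]dotvC dotv0 add0r.
have := is_derive_seq0 (v := psi0 * Lw q)
  (o := fun c => psi0 * oL c + dotv p (oX c)) dB.
move=> H; apply/esym/eqP; rewrite -subr_eq0 [diff_hamiltonian _ _ _ + _]addrC.
apply/eqP/H.
- have -> : (fun j => (@harmonic R j)^-1 *
        (psi0 * oL (harmonic j) + dotv p (oX (harmonic j)))) =
      (fun j => psi0 * ((harmonic j)^-1 * oL (harmonic j)) +
        dotv p ((harmonic j)^-1 *: oX (harmonic j))).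
    by apply/funext => j; rewrite mulrDr mulrCA dotvZ.
  rewrite -[X in _ --> X]addr0; apply: cvgD.
    by rewrite -[X in _ --> X](mulr0 psi0); apply: cvgM => //; exact: cvg_cst.
  have -> : 0 = \sum_(i < n) p 0 i * (0 : 'rV[R]_n) 0 i :> R.
    by rewrite big1// => i _; rewrite mxE mulr0.
  apply: cvg_big => [|i _]; first exact: add_continuous.
  apply: cvgM; first exact: cvg_cst.
  have cc : {for (0 : 'rV[R]_n), continuous (fun M : 'rV[R]_n => M 0 i : R)}.
    exact: coord_continuous.
  exact: (cvg_comp _ _ oX0 cc).
- apply: filterS id => j; set c := @harmonic R j => -[idL idX].
  have -> : B c = psi0 * (Lw (gam c) * tau c - Ft c) + dotv p (tau c *: phiw (gam c) - Xt c).
    rewrite dotvD dotvN dotvZ.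
    rewrite -[LHS]/((psi0 * Lw (gam c) + dotv p (phiw (gam c))) * tau c
      - (psi0 * Ft c + dotv p (Xt c))).
    by ring.
  rewrite -idL -idX [Xt c + _]addrC addrK.
  by ring.
Qed.

End families.

(** * The maximized Hamiltonian and the Noether identity along an extremal *)

Section extremals.
Set Implicit Arguments.
Unset Strict Implicit.
Variables (R : realType) (n m r : nat) (P : control_problem R n m).
Local Notation mu := (@lebesgue_measure R).
Local Notation a := (cp_a P).
Local Notation b := (cp_b P).
Implicit Types (x psi : R -> 'rV[R]_n) (u : R -> 'rV[R]_m).

Lemma extremal_admissible x u (psi0 : R) psi : extremal P x u psi0 psi -> admissible P x u.
Proof.
move=> [tr _ _ _ ext]; split => //; apply: lebesgue_aeS ext => t H /H[+ _ _].
by rewrite grad_hamiltonian_p.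
Qed.

Lemma max_hamiltonian x u (psi0 : R) psi : extremal P x u psi0 psi ->
  exists hmax : R -> R, abs_continuous a b hmax /\
    \forall t \ae mu, t \in `[a, b] ->
      hmax t = hamiltonian P t (x t) (u t) psi0 (psi t) /\
      forall s, s \in `[a, b] ->
        hamiltonian P s (x s) (u t) psi0 (psi s) <= hmax s.
Proof.
move=> [[acx _ [M uM] uO] _ acpsi _ ext].
(* [cp_Omega P] may be unbounded, and a supremum over all of it might be infinite at times other
   than [t]; the essential bound of [u] cuts it down. *)
pose S := [set v | cp_Omega P v /\ `|v| <= M].
have S0 : S !=set0.
  have [t /andP[at_ tb] ut] := ae_itv_exists (cp_ltab P) uM.
  have tab : t \in `[a, b] by rewrite in_itv/= !ltW.
  by exists (u t); split; [exact: uO|exact: ut].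
have SM v : S v -> `|v| <= M by case.
have acz : abs_continuous a b (fun t => (t, x t)).
  apply: (abs_continuous_dom (C := 1) (@abs_continuous_id _ a b) acx) => s t _ _ _.
  by rewrite mul1r prod_normE/= ge_max lerDl lerDr !normr_ge0.
have sL := C1_on_setT (cp_L_C1 P).
have sphi i := smooth_coord i (C1_on_setT (cp_phi_C1 P)).
have [hmax [ach hmaxP]] := abs_continuous_max psi0 sL sphi acz acpsi S0 SM.
exists hmax; split => //.
apply: lebesgue_aeS (lebesgue_aeI ext uM) => t [H utM] tab.
have Su : S (u t) by split; [exact: uO|exact: utM].
have [_ _ Hmax] := H tab.
split; last by move=> s sab; apply: (hmaxP s sab).1.
apply/eqP; rewrite eq_le; apply/andP; split; last exact: (hmaxP t tab).1.
by apply: (hmaxP t tab).2 => v [Ov _]; exact: Hmax.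
Qed.

(** By the state and adjoint equations, the derivative of the Hamiltonian with frozen control
    reduces to its partial derivative in time. The adjoint equation also turns the [psi'] term
    paired with [Xr] into minus the state part of the differential, and the assumed identity cancels
    what remains. *)
Lemma is_derive_noether x psi v (psi0 t : R) (Fr Tr : R -> R)
    (Xr : R -> 'rV[R]_n) dF dX dT w :
  is_derive t (1 : R) x (cp_phi P t (x t) v) ->
  is_derive t (1 : R) psi
    (- grad (fun y => hamiltonian P t y v psi0 (psi t)) (x t)) ->
  is_derive t (1 : R) Fr dF -> is_derive t (1 : R) Xr dX ->
  is_derive t (1 : R) Tr dT ->
  diff_hamiltonian P psi0 (t, x t, v) (psi t) (0, w) = 0 ->
  psi0 * dF + dotv (psi t) dX =
    diff_hamiltonian P psi0 (t, x t, v) (psi t) (Tr t, Xr t, w)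
    + hamiltonian P t (x t) v psi0 (psi t) * dT ->
  is_derive t (1 : R) (fun s => psi0 * Fr s + dotv (psi s) (Xr s)
    - hamiltonian P s (x s) v psi0 (psi s) * Tr s) 0.
Proof.
move=> dx dpsi dFr dXr dTr w0 E.
have did : is_derive t (1 : R) (@id R) 1 by exact: is_derive_id.
have dv : is_derive t (1 : R) (fun=> v) 0 by exact: is_derive_cst.
have dH := is_derive_hamiltonian P psi0 (is_derive_pair (is_derive_pair did dx) dv) dpsi.
have := is_deriveB (is_deriveD (is_deriveZ psi0 dFr) (is_derive_dotv dpsi dXr))
  (is_deriveM dH dTr).
set d := (X in is_derive _ _ _ X -> _); suff -> : d = 0 by [].
have gradN y : dotv (- grad (fun y => hamiltonian P t y v psi0 (psi t)) (x t)) y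
    = - diff_hamiltonian P psi0 (t, x t, v) (psi t) (0, y, 0).
  by rewrite dotvC dotvN dotvC dotv_grad_hamiltonian_y.
(* Linearity separates the time, state and control parts; the control part vanishes by [w0]. *)
have splitw (t' : R) (y' : 'rV[R]_n) (v' : 'rV[R]_m) :
    diff_hamiltonian P psi0 (t, x t, v) (psi t) (t', y', v') =
    t' * diff_hamiltonian P psi0 (t, x t, v) (psi t) (1, 0, 0)
    + diff_hamiltonian P psi0 (t, x t, v) (psi t) (0, y', 0)
    + diff_hamiltonian P psi0 (t, x t, v) (psi t) (0, v').
  rewrite -diff_hamiltonianZ -!diff_hamiltonianD.
  have -> // : (t', y', v') = t' *: (1, 0, 0) + (0, y', 0) + (0, v')
    :> R * 'rV[R]_n * 'rV[R]_m.
  congr pair; [congr pair|]; rewrite /= ?scaler0 ?addr0 ?add0r//.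
  exact/esym/mulr1.
rewrite /d /= gradN [diff_hamiltonian _ _ _ _ (1, _, _)]splitw !gradN.
have -> : diff_hamiltonian P psi0 (t, x t, v) (psi t) (0, 0) = 0.
  exact: diff_hamiltonian0.
move: E; rewrite splitw w0 addr0 -[psi0 *: dF]/(psi0 * dF).
move=> /(canRL (addrK _)) ->.
rewrite -[hamiltonian _ _ _ _ _ _ *: dT]/(_ * dT) -[Tr t *: _]/(Tr t * _).
by ring.
Qed.

Section invariance.
Variables (eps : R) (T : param_family R n m r R) (X : param_family R n m r 'rV[R]_n)
  (U : param_family R n m r 'rV[R]_m) (F : param_family R n m r R).
Hypotheses (eps_gt0 : 0 < eps) (qi : quasi_invariant P eps T X U F).

(* [U] stays in [Omega] for [s] of both signs, so [s = 0] is an interior maximum. *)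
Lemma diff_hamiltonian_U t y v (psi0 : R) p k : control_preserving P U ->
  t \in `[a, b] -> cp_Omega P v ->
  (forall v', cp_Omega P v' ->
    hamiltonian P t y v' psi0 p <= hamiltonian P t y v psi0 p) ->
  diff_hamiltonian P psi0 (t, y, v) p (0, 'D_(basisv R k) (fun s => U t y v s) 0) = 0.
Proof.
move=> cpU tab Ov Hmax; have [[_ _ CU _] h0 _] := qi.
have [_ _ U0] := h0 t y v tab Ov.
have dU := C1_family_is_derive y k CU eps_gt0 tab Ov.
have dty : is_derive (0 : R) (1 : R) (fun=> (t, y)) 0 by exact: is_derive_cst.
have dp : is_derive (0 : R) (1 : R) (fun=> p) 0 by exact: is_derive_cst.
have := is_derive_hamiltonian P psi0 (is_derive_pair dty dU) dp.
rewrite /= scale0r U0 dotvC dotv0 addr0 => /is_derive_max; apply.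
rewrite scale0r U0.
have c0 : (c *: basisv R k) @[c --> (0 : R)] --> (0 : 'rV[R]_r).
  rewrite -[X in _ --> X](scale0r (basisv R k)); apply: cvgZr_tmp; exact: cvg_id.
have : \forall c \near (0 : R), cp_Omega P (U t y v (c *: basisv R k)).
  exact: (c0 _ (cpU t y v tab Ov)).
by apply: filterS => c; exact: Hmax.
Qed.

Lemma ddt_T0 x u t : (forall s, s \in `[a, b] -> cp_Omega P (u s)) ->
  a < t < b -> ddt a b (along T x u 0) t = 1.
Proof.
move=> uO tab; apply: (@ddt_eq _ _ _ _ _ id) => //.
- exact: abs_continuous_id.
- by move=> s sab; have [_ h0 _] := qi; have [] := h0 s (x s) (u s) sab (uO s sab).
Qed.

(** [invariance_derivative] at [q = (t, x t, u t)], along the line in the direction of [s_k]. The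
    interchange assumption identifies the [s_k]-derivatives of [ddt] at 0 with [ddt] of [ds0]. *)
Lemma invariance_noether x u (psi0 : R) psi k : extremal P x u psi0 psi ->
  ds_dt_interchange P T x u -> ds_dt_interchange P X x u ->
  ds_dt_interchange P F x u ->
  \forall t \ae mu, a < t < b ->
    psi0 * ddt a b (ds0 F x u k) t + dotv (psi t) (ddt a b (ds0 X x u k) t) =
    diff_hamiltonian P psi0 (t, x t, u t) (psi t)
      (ds0 T x u k t, ds0 X x u k t, ds0 U x u k t)
    + hamiltonian P t (x t) (u t) psi0 (psi t) * ddt a b (ds0 T x u k) t.
Proof.
move=> ext iT iX iF.
have [[CT CX CU _] h0 hid] := qi.
have [[_ _ _ uO] _ _ _ _] := ext.
have [_ [oL [oX [lo idt]]]] := hid x u (extremal_admissible ext).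
(* A countable union of null sets is null, so one exceptional set serves for all [j]. Indices whose
   parameter is not below [eps] are vacuous. *)
have ae_id : \forall t \ae mu, forall j : nat,
    enorm (@harmonic R j *: basisv R k) < eps -> t \in `[a, b] ->
    let s := @harmonic R j *: basisv R k in
    cp_L P t (x t) (u t) + ddt a b (along F x u s) t + oL t s =
      cp_L P (along T x u s t) (along X x u s t) (along U x u s t)
        * ddt a b (along T x u s) t /\
    ddt a b (along X x u s) t + oX t s =
      ddt a b (along T x u s) t *:
        cp_phi P (along T x u s t) (along X x u s t) (along U x u s t).
  apply: ae_foralln => j.
  have [se|se] := ltP (enorm (@harmonic R j *: basisv R k)) eps.
    by apply: lebesgue_aeS (idt _ se) => t H _.
  by apply: aeW.
have := lebesgue_aeI (lebesgue_aeI ae_id lo)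
  (lebesgue_aeI (lebesgue_aeI (iT k).2 (iX k).2) (iF k).2).
apply: lebesgue_aeS => t [[idj lot] [[dT dX] dF]] tab'.
have tab : t \in `[a, b] by move: tab' => /andP[? ?]; rewrite in_itv/= !ltW.
have Ou := uO t tab.
have [oLt oXt] := lot tab.
have [_ _ {}dT] := dT tab; have [_ _ {}dX] := dX tab; have [_ _ {}dF] := dF tab.
have dgT := C1_family_is_derive (x t) k CT eps_gt0 tab Ou.
have dgX := C1_family_is_derive (x t) k CX eps_gt0 tab Ou.
have dgU := C1_family_is_derive (x t) k CU eps_gt0 tab Ou.
have [T0 X0 U0] := h0 t (x t) (u t) tab Ou.
apply: (@invariance_derivative _ _ _ P psi0 _ (psi t) _ _ _ _
  (fun c => oL t (c *: basisv R k)) (fun c => oX t (c *: basisv R k)) _ _ _ _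
  _ _ (is_derive_pair (is_derive_pair dgT dgX) dgU)
  (is_derive_dir0 dT) (is_derive_dir0 dF) (is_derive_dir0 dX)
  (little_o_harmonic k oLt) (little_o_harmonic k oXt)).
- by rewrite scale0r T0 X0 U0.
- by rewrite scale0r ddt_T0.
- have : \forall j \near \oo, @harmonic R j < eps.
    exact: (cvgr_lt _ (@cvg_harmonic R)).
  apply: filterS => j je; apply: idj => //.
  by rewrite enorm_basis gtr0_norm// harmonic_gt0.
Qed.

End invariance.
End extremals.

Theorem theorem5p1 (R : realType) (n m r : nat) (P : control_problem R n m)
  (eps : R) (T : param_family R n m r R) (X : param_family R n m r 'rV[R]_n)
  (U : param_family R n m r 'rV[R]_m) (F : param_family R n m r R)
  (eps_gt0 : 0 < eps)
  (hqi : quasi_invariant P eps T X U F)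
  (hinter : forall x u, admissible P x u ->
     [/\ ds_dt_interchange P T x u, ds_dt_interchange P X x u & ds_dt_interchange P F x u])
  (hU : control_preserving P U)
  (x : R -> 'rV[R]_n) (u : R -> 'rV[R]_m) (psi0 : R) (psi : R -> 'rV[R]_n)
  (hext : extremal P x u psi0 psi) (k : 'I_r) :
  exists c : R, \forall t \ae (@lebesgue_measure R), t \in `[cp_a P, cp_b P] ->
    psi0 * ds0 F x u k t + dotv (psi t) (ds0 X x u k t)
      - hamiltonian P t (x t) (u t) psi0 (psi t) * ds0 T x u k t = c.
Proof.
have [iT iX iF] := hinter x u (extremal_admissible hext).
have noether := invariance_noether eps_gt0 hqi k hext iT iX iF.
have [hmax [ach hmaxP]] := max_hamiltonian hext.
have [[acx _ _ uO] _ acpsi _ ext] := hext.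
set a := cp_a P in noether hmaxP ach *; set b := cp_b P in noether hmaxP ach *.
set mu := @lebesgue_measure R.
have [aeT dT] := iT k; have [aeX dX] := iX k; have [aeF dF] := iF k.
pose Tr := ac_rep a b (ds0 T x u k); pose Xr := ac_rep a b (ds0 X x u k).
pose Fr := ac_rep a b (ds0 F x u k).
have [acT TE] := ac_repP aeT; have [acX XE] := ac_repP aeX.
have [acF FE] := ac_repP aeF.
(* The [ds0] terms are absolutely continuous only up to null sets, so the argument runs on their
   representatives. *)
pose A t := psi0 * Fr t + dotv (psi t) (Xr t).
have acA : abs_continuous a b A.
  apply: abs_continuousD; last exact: abs_continuous_dotv.
  by apply: abs_continuousM => //; exact: abs_continuous_cst.
have repE : \forall t \ae mu, t \in `[a, b] ->
    [/\ ds0 T x u k t = Tr t, ds0 X x u k t = Xr t & ds0 F x u k t = Fr t].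
  apply: lebesgue_aeS (lebesgue_aeI TE (lebesgue_aeI XE FE)).
  by move=> t [H1 [H2 H3]] tab; split; [exact: H1|exact: H2|exact: H3].
have touch : \forall t \ae mu, a < t < b -> touches_below a b hmax A Tr t.
  have := lebesgue_aeI (lebesgue_aeI noether hmaxP)
    (lebesgue_aeI (lebesgue_aeI repE ext) (lebesgue_aeI dT (lebesgue_aeI dX dF))).
  apply: lebesgue_aeS.
  move=> t [[nt hmt] [[rept extt] [{}dT [{}dX {}dF]]]] tab'.
  have tab : t \in `[a, b] by move: tab' => /andP[? ?]; rewrite in_itv/= !ltW.
  have {}nt := nt tab'.
  have [_ /is_derive_ddt {}dT _] := dT tab.
  have [_ /is_derive_ddt {}dX _] := dX tab.
  have [_ /is_derive_ddt {}dF _] := dF tab.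
  have [hm hle] := hmt tab; have [Tt Xt Ft] := rept tab.
  have [dx dpsi Hmax] := extt tab.
  rewrite grad_hamiltonian_p in dx.
  (* With the control frozen at [u t] the Hamiltonian is differentiable at [t], although along [u]
     it is only measurable. *)
  exists (fun s => hamiltonian P s (x s) (u t) psi0 (psi s)).
  have dgam : is_derive t (1 : R) (fun s => (s, x s, u t))
      (1, cp_phi P t (x t) (u t), 0).
    have did : is_derive t (1 : R) (@id R) 1 by exact: is_derive_id.
    have du : is_derive t (1 : R) (fun=> u t) 0 by exact: is_derive_cst.
    exact: is_derive_pair (is_derive_pair did dx) du.
  have dH := is_derive_hamiltonian P psi0 dgam dpsi.
  split => //.
  - apply: differentiable_continuous; apply/derivable1_diffP.
    by have [] := dH.
  - have U0 := diff_hamiltonian_U eps_gt0 hqi k hU tab (uO t tab) Hmax.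
    rewrite Tt Xt in nt.
    exact: (is_derive_noether dx dpsi dF dX dT U0 nt).
have key := majorant_cst ach acA acT touch.
(* The constant is the value at [a] of the absolutely continuous version; [repE] and [hmaxP] lead
   back to the original expression almost everywhere. *)
exists (A a - hmax a * Tr a).
apply: lebesgue_aeS (lebesgue_aeI repE hmaxP) => t [rept hmt] tab.
have [-> -> ->] := rept tab; have [<- _] := hmt tab.
exact: key.
Qed.
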